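(* Let $\mathfrak k$ be the compact real form of a complex hyperbolic Kac–Moody algebra $\mathfrak g$. The invariant symmetric bilinear form $(\cdot,\cdot)_{\mathfrak k}=-(\cdot,\cdot)|_{\mathfrak k}$ on $\mathfrak k$ is Lorentzian with signature $(\infty,1)$.
   Context: $\mathfrak g=\mathfrak g_{\mathbb C}(A)$ for an indecomposable symmetrizable generalized Cartan matrix $A=(a_{ij})_{1\le i,j\le\ell}$ of hyperbolic type: $A$ is of neither finite nor affine type, but every proper indecomposable principal submatrix is of finite or affine type. $\mathfrak g$ has Chevalley generators $e_i,f_i,h_i$, with Cartan subalgebra $\mathfrak h=\bigoplus_i\mathbb Ch_i$ and $\alpha_i(h_j)=a_{ij}$. $\omega$ is the conjugate-linear involution of $\mathfrak g$ with $\omega(e_i)=-f_i$, $\omega(f_i)=-e_i$, $\omega(h_i)=-h_i$, and $\mathfrak k=\{x\in\mathfrak g:\omega(x)=x\}$, a real Lie algebra. $(\cdot,\cdot)$ is the nondegenerate invariant symmetric bilinear form on $\mathfrak g$, unique up to scaling and scaled so that $(h_i,h_i)>0$ for all $i$. Signature $(\infty,1)$ means: $\mathfrak k$ is an orthogonal direct sum of an infinite-dimensional positive definite subspace and a one-dimensional negative definite subspace. *)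

(* Defs.v *)
From HB Require Import structures.
From mathcomp Require Import all_boot all_order all_algebra.
From mathcomp Require Import boolp reals.
From mathcomp Require Import complex.

Set Implicit Arguments.
Unset Strict Implicit.
Unset Printing Implicit Defensive.

Import Order.TTheory GRing.Theory Num.Theory.

Local Open Scope ring_scope.
Local Open Scope quotient_scope.

HB.mixin Record Lmodule_isLieAlgebra (K : comNzRingType) V
    of GRing.Lmodule K V := {
  lie : V -> V -> V;
  lieDl : forall x y z, lie (x + y) z = lie x z + lie y z;
  lieDr : forall x y z, lie x (y + z) = lie x y + lie x z;
  lieZl : forall (a : K) x y, lie (a *: x) y = a *: lie x y;
  lieZr : forall (a : K) x y, lie x (a *: y) = a *: lie x y;
  liexx : forall x, lie x x = 0;
  lie_jacobi : forall x y z,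
    lie x (lie y z) + lie y (lie z x) + lie z (lie x y) = 0
}.

#[short(type="lieAlgType")]
HB.structure Definition LieAlgebra (K : comNzRingType) :=
  { V of GRing.Lmodule K V & Lmodule_isLieAlgebra K V }.

Notation "[[ x , y ]]" := (lie x y)
  (at level 0, format "[[ x ,  y ]]") : ring_scope.

Definition invariant_form (K : comNzRingType) (L : lieAlgType K)
    (B : L -> L -> K) : Prop :=
  forall x y z, B [[x, y]] z = B x [[y, z]].

Inductive lie_term (K X : Type) : Type :=
  | LGen of X
  | LZero
  | LAdd of lie_term K X & lie_term K X
  | LScale of K & lie_term K X
  | LBr of lie_term K X & lie_term K X.
Arguments LGen {K X}.
Arguments LZero {K X}.

Section Presented.
Variables (K : comNzRingType) (X : Type).
Local Notation term := (lie_term K X).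
Variable rels : term -> term -> Prop.

(* The least congruence containing [rels] and the axioms of Lie algebras. *)
Inductive lie_congr : term -> term -> Prop :=
  | LC_rels t u : rels t u -> lie_congr t u
  | LC_refl t : lie_congr t t
  | LC_sym t u : lie_congr t u -> lie_congr u t
  | LC_trans t u v : lie_congr t u -> lie_congr u v -> lie_congr t v
  | LC_add t t' u u' : lie_congr t t' -> lie_congr u u' ->
      lie_congr (LAdd t u) (LAdd t' u')
  | LC_scale a t t' : lie_congr t t' -> lie_congr (LScale a t) (LScale a t')
  | LC_br t t' u u' : lie_congr t t' -> lie_congr u u' ->
      lie_congr (LBr t u) (LBr t' u')
  | LC_addA t u v : lie_congr (LAdd t (LAdd u v)) (LAdd (LAdd t u) v)
  | LC_addC t u : lie_congr (LAdd t u) (LAdd u t)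
  | LC_add0 t : lie_congr (LAdd LZero t) t
  | LC_addN t : lie_congr (LAdd (LScale (-1) t) t) LZero
  | LC_scaleA a b t : lie_congr (LScale a (LScale b t)) (LScale (a * b) t)
  | LC_scale1 t : lie_congr (LScale 1 t) t
  | LC_scaleDr a t u :
      lie_congr (LScale a (LAdd t u)) (LAdd (LScale a t) (LScale a u))
  | LC_scaleDl a b t :
      lie_congr (LScale (a + b) t) (LAdd (LScale a t) (LScale b t))
  | LC_brDl t u v : lie_congr (LBr (LAdd t u) v) (LAdd (LBr t v) (LBr u v))
  | LC_brDr t u v : lie_congr (LBr t (LAdd u v)) (LAdd (LBr t u) (LBr t v))
  | LC_brZl a t u : lie_congr (LBr (LScale a t) u) (LScale a (LBr t u))
  | LC_brZr a t u : lie_congr (LBr t (LScale a u)) (LScale a (LBr t u))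
  | LC_brxx t : lie_congr (LBr t t) LZero
  | LC_jacobi t u v :
      lie_congr (LAdd (LAdd (LBr t (LBr u v)) (LBr u (LBr v t)))
                      (LBr v (LBr t u))) LZero.

HB.instance Definition _ := gen_eqMixin term.
HB.instance Definition _ := gen_choiceMixin term.

Definition lie_congrb : rel term := fun t u => `[< lie_congr t u >].

Fact lie_congrb_refl : reflexive lie_congrb.
Proof. by move=> t; apply/asboolP; apply: LC_refl. Qed.

Fact lie_congrb_sym : symmetric lie_congrb.
Proof. by move=> t u; apply/asboolP/asboolP => /LC_sym. Qed.

Fact lie_congrb_trans : transitive lie_congrb.
Proof.
by move=> u t v /asboolP tu /asboolP uv; apply/asboolP; apply: LC_trans uv.
Qed.

Canonical lie_equiv :=
  EquivRel lie_congrb lie_congrb_refl lie_congrb_sym lie_congrb_trans.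

Definition presented_lie : Type := {eq_quot lie_equiv}.
HB.instance Definition _ := EqQuotient.on presented_lie.
HB.instance Definition _ := Choice.on presented_lie.

Definition lie_class (t : term) : presented_lie := \pi_presented_lie t.

Lemma lie_classW (P : presented_lie -> Prop) :
  (forall t, P (lie_class t)) -> forall x, P x.
Proof. exact: quotW. Qed.

Lemma lie_class_repr x : lie_class (repr x) = x.
Proof. exact: reprK. Qed.

Lemma pi_lieP t u :
  (lie_class t = lie_class u) <-> lie_congr t u.
Proof.
by split=> [/eqquotP/asboolP//|tu]; apply/eqquotP/asboolP.
Qed.

Definition pl_gen (x : X) : presented_lie := lie_class (LGen x).
Definition pl_zero : presented_lie := lie_class LZero.
Definition pl_add (x y : presented_lie) : presented_lie :=
  lie_class (LAdd (repr x) (repr y)).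
Definition pl_scale (a : K) (x : presented_lie) : presented_lie :=
  lie_class (LScale a (repr x)).
Definition pl_opp (x : presented_lie) : presented_lie := pl_scale (-1) x.
Definition pl_br (x y : presented_lie) : presented_lie :=
  lie_class (LBr (repr x) (repr y)).

Lemma lie_congr_repr t : lie_congr (repr (lie_class t)) t.
Proof. by apply/pi_lieP; rewrite lie_class_repr. Qed.

Lemma pl_addE t u : pl_add (lie_class t) (lie_class u) = lie_class (LAdd t u).
Proof. by apply/pi_lieP; apply: LC_add; apply: lie_congr_repr. Qed.

Lemma pl_scaleE a t : pl_scale a (lie_class t) = lie_class (LScale a t).
Proof. by apply/pi_lieP; apply: LC_scale; apply: lie_congr_repr. Qed.

Lemma pl_brE t u : pl_br (lie_class t) (lie_class u) = lie_class (LBr t u).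
Proof. by apply/pi_lieP; apply: LC_br; apply: lie_congr_repr. Qed.

Fact pl_addA : associative pl_add.
Proof.
elim/lie_classW=> t; elim/lie_classW=> u; elim/lie_classW=> v.
by rewrite !pl_addE; apply/pi_lieP/LC_addA.
Qed.

Fact pl_addC : commutative pl_add.
Proof.
by elim/lie_classW=> t; elim/lie_classW=> u; rewrite !pl_addE; apply/pi_lieP/LC_addC.
Qed.

Fact pl_add0 : left_id pl_zero pl_add.
Proof. by elim/lie_classW=> t; rewrite !pl_addE; apply/pi_lieP/LC_add0. Qed.

Fact pl_addN : left_inverse pl_zero pl_opp pl_add.
Proof.
by elim/lie_classW=> t; rewrite /pl_opp pl_scaleE !pl_addE; apply/pi_lieP/LC_addN.
Qed.

HB.instance Definition _ :=
  GRing.isZmodule.Build presented_lie pl_addA pl_addC pl_add0 pl_addN.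

Lemma pi_lie0 : lie_class LZero = 0. Proof. by []. Qed.

Lemma pi_lieD t u :
  lie_class (LAdd t u) = lie_class t + lie_class u.
Proof. by rewrite -pl_addE. Qed.

Fact pl_scaleA a b x : pl_scale a (pl_scale b x) = pl_scale (a * b) x.
Proof.
by elim/lie_classW: x => t; rewrite !pl_scaleE; apply/pi_lieP/LC_scaleA.
Qed.

Fact pl_scale1 : left_id 1 pl_scale.
Proof. by elim/lie_classW=> t; rewrite !pl_scaleE; apply/pi_lieP/LC_scale1. Qed.

Fact pl_scaleDr : right_distributive pl_scale +%R.
Proof.
move=> a; elim/lie_classW=> t; elim/lie_classW=> u.
by rewrite -pi_lieD !pl_scaleE -pi_lieD; apply/pi_lieP/LC_scaleDr.
Qed.

Fact pl_scaleDl x : {morph pl_scale^~ x : a b / a + b}.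
Proof.
move=> a b; elim/lie_classW: x => t; rewrite !pl_scaleE.
by rewrite -pi_lieD; apply/pi_lieP/LC_scaleDl.
Qed.

HB.instance Definition _ := GRing.Zmodule_isLmodule.Build K presented_lie
  pl_scaleA pl_scale1 pl_scaleDr pl_scaleDl.

Lemma pi_lieZ a t : lie_class (LScale a t) = a *: lie_class t.
Proof. by rewrite -pl_scaleE. Qed.

Fact pl_brDl x y z : pl_br (x + y) z = pl_br x z + pl_br y z.
Proof.
elim/lie_classW: x => t; elim/lie_classW: y => u; elim/lie_classW: z => v.
by rewrite -pi_lieD !pl_brE -pi_lieD; apply/pi_lieP/LC_brDl.
Qed.

Fact pl_brDr x y z : pl_br x (y + z) = pl_br x y + pl_br x z.
Proof.
elim/lie_classW: x => t; elim/lie_classW: y => u; elim/lie_classW: z => v.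
by rewrite -pi_lieD !pl_brE -pi_lieD; apply/pi_lieP/LC_brDr.
Qed.

Fact pl_brZl a x y : pl_br (a *: x) y = a *: pl_br x y.
Proof.
elim/lie_classW: x => t; elim/lie_classW: y => u.
by rewrite -pi_lieZ !pl_brE -pi_lieZ; apply/pi_lieP/LC_brZl.
Qed.

Fact pl_brZr a x y : pl_br x (a *: y) = a *: pl_br x y.
Proof.
elim/lie_classW: x => t; elim/lie_classW: y => u.
by rewrite -pi_lieZ !pl_brE -pi_lieZ; apply/pi_lieP/LC_brZr.
Qed.

Fact pl_brxx x : pl_br x x = 0.
Proof. by elim/lie_classW: x => t; rewrite pl_brE; apply/pi_lieP/LC_brxx. Qed.

Fact pl_jacobi x y z :
  pl_br x (pl_br y z) + pl_br y (pl_br z x) + pl_br z (pl_br x y) = 0.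
Proof.
elim/lie_classW: x => t; elim/lie_classW: y => u; elim/lie_classW: z => v.
by rewrite !pl_brE -!pi_lieD; apply/pi_lieP/LC_jacobi.
Qed.

HB.instance Definition _ := Lmodule_isLieAlgebra.Build K presented_lie
  pl_brDl pl_brDr pl_brZl pl_brZr pl_brxx pl_jacobi.

Lemma pi_lieB t u : lie_class (LBr t u) = [[lie_class t, lie_class u]].
Proof. by rewrite -pl_brE. Qed.

(* The universal property is [sigma := idfun]; other [sigma] give semilinear
   maps, such as the conjugate-linear [omega] below. *)
Section Lift.
Variables (L : lieAlgType K) (sigma : {rmorphism K -> K}) (rho : X -> L).

Fixpoint lie_eval (t : term) : L :=
  match t with
  | LGen x => rho x
  | LZero => 0
  | LAdd t u => lie_eval t + lie_eval u
  | LScale a t => sigma a *: lie_eval t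
  | LBr t u => [[lie_eval t, lie_eval u]]
  end.

Hypothesis rho_rels : forall t u, rels t u -> lie_eval t = lie_eval u.

Lemma lie_eval_congr t u : lie_congr t u -> lie_eval t = lie_eval u.
Proof.
elim=> //=.
- by move=> ? ? ? _ -> _ ->.
- by move=> ? ? ? ? _ -> _ ->.
- by move=> ? ? ? _ ->.
- by move=> ? ? ? ? _ -> _ ->.
- by move=> *; rewrite addrA.
- by move=> *; rewrite addrC.
- by move=> *; rewrite add0r.
- by move=> *; rewrite rmorphN1 scaleN1r addNr.
- by move=> *; rewrite scalerA rmorphM.
- by move=> *; rewrite rmorph1 scale1r.
- by move=> *; rewrite scalerDr.
- by move=> *; rewrite rmorphD scalerDl.
- by move=> *; rewrite lieDl.
- by move=> *; rewrite lieDr.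
- by move=> *; rewrite lieZl.
- by move=> *; rewrite lieZr.
- by move=> *; rewrite liexx.
- by move=> *; rewrite lie_jacobi.
Qed.

Definition presented_lift (x : presented_lie) : L := lie_eval (repr x).

Lemma presented_liftE t : presented_lift (lie_class t) = lie_eval t.
Proof. by apply: lie_eval_congr; apply: lie_congr_repr. Qed.

Lemma presented_lift_gen x : presented_lift (pl_gen x) = rho x.
Proof. exact: presented_liftE. Qed.

Lemma presented_liftD x y :
  presented_lift (x + y) = presented_lift x + presented_lift y.
Proof.
by elim/lie_classW: x => t; elim/lie_classW: y => u; rewrite -pi_lieD !presented_liftE.
Qed.

Lemma presented_liftZ a x :
  presented_lift (a *: x) = sigma a *: presented_lift x.
Proof. by elim/lie_classW: x => t; rewrite -pi_lieZ !presented_liftE. Qed.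

Lemma presented_lift_lie x y :
  presented_lift [[x, y]] = [[presented_lift x, presented_lift y]].
Proof.
by elim/lie_classW: x => t; elim/lie_classW: y => u; rewrite -pi_lieB !presented_liftE.
Qed.

End Lift.
End Presented.

Section MatrixTypes.
Variables (F : realFieldType) (n : nat).

Definition vec_pos (u : 'cV[F]_n) : Prop := forall i, 0 < u i 0.
Definition vec_nneg (u : 'cV[F]_n) : Prop := forall i, 0 <= u i 0.

(* Vinberg's trichotomy, in the form of Kac, Infinite-dimensional Lie
   algebras, Theorem 4.3. *)
Definition finite_type (M : 'M[F]_n) : Prop :=
  [/\ \det M != 0,
      exists2 u : 'cV[F]_n, vec_pos u & vec_pos (M *m u)
    & forall v : 'cV[F]_n, vec_nneg (M *m v) -> vec_pos v \/ v = 0].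

Definition affine_type (M : 'M[F]_n) : Prop :=
  [/\ (\rank M).+1 = n,
      exists2 u : 'cV[F]_n, vec_pos u & M *m u = 0
    & forall v : 'cV[F]_n, vec_nneg (M *m v) -> M *m v = 0].

End MatrixTypes.

Definition is_gcm n (A : 'M[int]_n) : Prop :=
  [/\ forall i, A i i = 2,
      forall i j, i != j -> A i j <= 0
    & forall i j, A i j = 0 -> A j i = 0].

Definition symmetrizable n (A : 'M[int]_n) : Prop :=
  exists2 d : 'rV[rat]_n, (forall i, 0 < d 0 i)
    & (diag_mx d *m map_mx intr A)^T = diag_mx d *m map_mx intr A.

Definition indecomposable n (A : 'M[int]_n) : Prop :=
  (0 < n)%N /\
  forall S : {set 'I_n}, S != set0 -> S != [set: 'I_n] ->
    exists i j, [/\ i \in S, j \notin S & (A i j != 0) || (A j i != 0)].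

Definition principal_submx n (A : 'M[int]_n) (S : {set 'I_n}) : 'M[int]_#|S| :=
  \matrix_(i, j) A (enum_val i) (enum_val j).

Definition finite_or_affine (F : realFieldType) n (A : 'M[int]_n) : Prop :=
  finite_type (map_mx intr A : 'M[F]_n) \/
  affine_type (map_mx intr A : 'M[F]_n).

Definition hyperbolic_type (F : realFieldType) n (A : 'M[int]_n) : Prop :=
  ~ finite_or_affine F A /\
  forall S : {set 'I_n}, S \proper [set: 'I_n] ->
    indecomposable (principal_submx A S) ->
    finite_or_affine F (principal_submx A S).

Inductive chevalley_gen (n : nat) : Type :=
  | GenE of 'I_n
  | GenF of 'I_n
  | GenH of 'I_n.

(* The convention is alpha_i (h_j) = A i j, so that e_j is a lowest weight
   vector of weight A j i for the sl2-triple (e_i, h_i, f_i); whence the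
   exponents of the Serre relations.  For symmetrizable A the Lie algebra
   presented by these relations has no nonzero ideal that meets the span of
   the h_i trivially (Gabber-Kac), so it also agrees with the definition of
   the Kac-Moody algebra by that property. *)
Inductive chevalley_rels (K : comNzRingType) n (A : 'M[int]_n) :
    lie_term K (chevalley_gen n) -> lie_term K (chevalley_gen n) -> Prop :=
  | CR_hh i j : chevalley_rels A (LBr (LGen (GenH i)) (LGen (GenH j))) LZero
  | CR_he i j : chevalley_rels A (LBr (LGen (GenH j)) (LGen (GenE i)))
                  (LScale (A i j)%:~R (LGen (GenE i)))
  | CR_hf i j : chevalley_rels A (LBr (LGen (GenH j)) (LGen (GenF i)))
                  (LScale (- (A i j)%:~R) (LGen (GenF i)))
  | CR_ef i : chevalley_rels A (LBr (LGen (GenE i)) (LGen (GenF i)))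
                (LGen (GenH i))
  | CR_ef0 i j : i != j ->
      chevalley_rels A (LBr (LGen (GenE i)) (LGen (GenF j))) LZero
  | CR_serre_e i j : i != j ->
      chevalley_rels A
        (iter `|1 - A j i|%N (LBr (LGen (GenE i))) (LGen (GenE j))) LZero
  | CR_serre_f i j : i != j ->
      chevalley_rels A
        (iter `|1 - A j i|%N (LBr (LGen (GenF i))) (LGen (GenF j))) LZero.

Section KacMoody.
Variables (K : comNzRingType) (n : nat) (A : 'M[int]_n).

Definition kac_moody : Type := presented_lie (chevalley_rels (K := K) A).
HB.instance Definition _ := LieAlgebra.on kac_moody.

Definition km_e (i : 'I_n) : kac_moody := pl_gen _ (GenE i).
Definition km_f (i : 'I_n) : kac_moody := pl_gen _ (GenF i).
Definition km_h (i : 'I_n) : kac_moody := pl_gen _ (GenH i).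

Lemma km_hh i j : [[km_h i, km_h j]] = 0.
Proof. by rewrite -pi_lieB; apply/pi_lieP/LC_rels/CR_hh. Qed.

Lemma km_he i j : [[km_h j, km_e i]] = (A i j)%:~R *: km_e i.
Proof. by rewrite -pi_lieB -pi_lieZ; apply/pi_lieP/LC_rels/CR_he. Qed.

Lemma km_hf i j : [[km_h j, km_f i]] = - (A i j)%:~R *: km_f i.
Proof. by rewrite -pi_lieB -pi_lieZ; apply/pi_lieP/LC_rels/CR_hf. Qed.

Lemma km_ef i j : [[km_e i, km_f j]] = if i == j then km_h i else 0.
Proof.
case: (eqVneq i j) => [->|ij]; rewrite -pi_lieB; apply/pi_lieP/LC_rels.
  exact: CR_ef.
exact: CR_ef0.
Qed.

Let pi_iter m (t u : lie_term K (chevalley_gen n)) :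
  lie_class (chevalley_rels A) (iter m (LBr t) u) =
  iter m (lie (lie_class _ t : kac_moody)) (lie_class _ u : kac_moody).
Proof. by elim: m => //= m <-; rewrite -pi_lieB. Qed.

Lemma km_serre_e i j : i != j ->
  iter `|1 - A j i|%N (lie (km_e i)) (km_e j) = 0.
Proof. by move=> ij; rewrite -pi_iter; apply/pi_lieP/LC_rels/CR_serre_e. Qed.

Lemma km_serre_f i j : i != j ->
  iter `|1 - A j i|%N (lie (km_f i)) (km_f j) = 0.
Proof. by move=> ij; rewrite -pi_iter; apply/pi_lieP/LC_rels/CR_serre_f. Qed.

End KacMoody.

Section LieTheory.
Variables (K : comNzRingType) (L : lieAlgType K).
Implicit Types x y : L.

Lemma lieNl x y : [[- x, y]] = - [[x, y]].
Proof. by rewrite -scaleN1r lieZl scaleN1r. Qed.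

Lemma lieNr x y : [[x, - y]] = - [[x, y]].
Proof. by rewrite -scaleN1r lieZr scaleN1r. Qed.

Lemma lieC x y : [[x, y]] = - [[y, x]].
Proof.
apply/eqP; rewrite -addr_eq0; apply/eqP.
by have := liexx (x + y); rewrite lieDl !lieDr !liexx add0r addr0.
Qed.

Lemma iter_lieN m x y :
  iter m (lie (- x)) (- y) = (-1) ^+ m.+1 *: iter m (lie x) y.
Proof.
elim: m => [|m IHm] /=; first by rewrite expr1 scaleN1r.
by rewrite IHm lieNl lieZr -scaleN1r scalerA -exprS.
Qed.

End LieTheory.

Section Omega.
Variables (R : rcfType) (n : nat) (A : 'M[int]_n).
Local Notation g := (kac_moody R[i] A).

Definition omega_gen (x : chevalley_gen n) : g :=
  match x with
  | GenE i => - km_f _ A i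
  | GenF i => - km_e _ A i
  | GenH i => - km_h _ A i
  end.

Let omega_eval := lie_eval (@conjc R) omega_gen.

Let omega_eval_iter m t u :
  omega_eval (iter m (LBr t) u) = iter m (lie (omega_eval t)) (omega_eval u).
Proof. by elim: m => //= m ->. Qed.

Fact omega_rels t u : chevalley_rels A t u -> omega_eval t = omega_eval u.
Proof.
case=> [i j|i j|i j|i|i j ij|i j ij|i j ij]; rewrite ?omega_eval_iter /=.
- by rewrite lieNl lieNr km_hh !oppr0.
- by rewrite lieNl lieNr km_hf opprK scaleNr scalerN rmorph_int.
- by rewrite lieNl lieNr km_he opprK scalerN rmorphN rmorph_int scaleNr opprK.
- by rewrite lieNl lieNr opprK lieC km_ef eqxx.
- by rewrite lieNl lieNr opprK lieC km_ef eq_sym (negPf ij) oppr0.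
- by rewrite iter_lieN km_serre_f // scaler0.
- by rewrite iter_lieN km_serre_e // scaler0.
Qed.

Definition omega : g -> g := presented_lift (@conjc R) omega_gen.

Lemma omegaD x y : omega (x + y) = omega x + omega y.
Proof. exact: (presented_liftD omega_rels). Qed.

Lemma omegaZ a x : omega (a *: x) = a^*%C *: omega x.
Proof. exact: (presented_liftZ omega_rels). Qed.

Lemma omega_lie x y : omega [[x, y]] = [[omega x, omega y]].
Proof. exact: (presented_lift_lie omega_rels). Qed.

Lemma omega_e i : omega (km_e _ A i) = - km_f _ A i.
Proof. exact: (presented_lift_gen omega_rels). Qed.

Lemma omega_f i : omega (km_f _ A i) = - km_e _ A i.
Proof. exact: (presented_lift_gen omega_rels). Qed.

Lemma omega_h i : omega (km_h _ A i) = - km_h _ A i.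
Proof. exact: (presented_lift_gen omega_rels). Qed.

Lemma omega0 : omega 0 = 0.
Proof. by have := omegaZ 0 0; rewrite conjc0 !scale0r. Qed.

Lemma omegaN x : omega (- x) = - omega x.
Proof. by rewrite -scaleN1r omegaZ rmorphN1 scaleN1r. Qed.

Lemma omegaK : involutive omega.
Proof.
elim/lie_classW; elim=> [x||t IHt u IHu|a t IHt|t IHt u IHu].
- case: x => i; rewrite -/(pl_gen _ _).
  + by rewrite -/(km_e _ A i) omega_e omegaN omega_f opprK.
  + by rewrite -/(km_f _ A i) omega_f omegaN omega_e opprK.
  + by rewrite -/(km_h _ A i) omega_h omegaN omega_h opprK.
- by rewrite pi_lie0 !omega0.
- by rewrite pi_lieD !omegaD IHt IHu.
- by rewrite pi_lieZ !omegaZ IHt conjcK.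
- by rewrite pi_lieB !omega_lie IHt IHu.
Qed.

End Omega.

(* An alias: V itself carries the R[i]-structure, its realification the
   R-structure. *)
Definition realification (R : rcfType) (V : Type) : Type := V.

Section Realification.
Variables (R : rcfType) (L : lieAlgType R[i]).
Local Notation LR := (realification R L).

HB.instance Definition _ := GRing.Zmodule.on LR.

Definition real_scale (r : R) (x : LR) : LR := r%:C%C *: (x : L).

Fact real_scaleA a b x : real_scale a (real_scale b x) = real_scale (a * b) x.
Proof. by rewrite /real_scale scalerA rmorphM. Qed.

Fact real_scale1 : left_id 1 real_scale.
Proof. by move=> x; rewrite /real_scale rmorph1 scale1r. Qed.

Fact real_scaleDr : right_distributive real_scale +%R.
Proof. by move=> a x y; rewrite /real_scale scalerDr. Qed.

Fact real_scaleDl x : {morph real_scale^~ x : a b / a + b}.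
Proof. by move=> a b; rewrite /real_scale rmorphD scalerDl. Qed.

HB.instance Definition _ := GRing.Zmodule_isLmodule.Build R LR
  real_scaleA real_scale1 real_scaleDr real_scaleDl.

Definition real_lie (x y : LR) : LR := lie (x : L) (y : L).

HB.instance Definition _ := Lmodule_isLieAlgebra.Build R LR
  (@lieDl _ L) (@lieDr _ L)
  (fun a x y => lieZl a%:C%C (x : L) (y : L))
  (fun a x y => lieZr a%:C%C (x : L) (y : L))
  (@liexx _ L) (@lie_jacobi _ L).

End Realification.

Section CompactForm.
Variables (R : rcfType) (n : nat) (A : 'M[int]_n).
Local Notation g := (kac_moody R[i] A).

Definition omega_fixed : {pred realification R g} :=
  [pred x : realification R g | omega (x : g) == x].

Fact omega_fixed_submod : submod_closed omega_fixed.
Proof.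
split=> [|a x y]; rewrite !inE; first by rewrite omega0.
move=> /eqP xfix /eqP yfix; apply/eqP.
by rewrite -[LHS]/(omega (a%:C%C *: (x : g) + y)) omegaD omegaZ
  conjc_real xfix yfix.
Qed.

HB.instance Definition _ :=
  GRing.isSubmodClosed.Build R _ omega_fixed omega_fixed_submod.

Record compact_form : Type := CompactForm {
  compact_val : realification R g;
  _ : compact_val \in omega_fixed
}.

HB.instance Definition _ := [isSub for compact_val].
HB.instance Definition _ := [Choice of compact_form by <:].
HB.instance Definition _ := [SubChoice_isSubLmodule of compact_form by <:].

Fact compact_lie_fixed (x y : compact_form) :
  [[val x, val y]] \in omega_fixed.
Proof.
case: x y => x /= /eqP xfix [y /= /eqP yfix]; apply/eqP.
by rewrite -[LHS]/(omega [[x : g, y : g]]) omega_lie xfix yfix.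
Qed.

Definition compact_lie (x y : compact_form) : compact_form :=
  CompactForm (compact_lie_fixed x y).

Fact compact_lieDl x y z :
  compact_lie (x + y) z = compact_lie x z + compact_lie y z.
Proof. by apply: val_inj; rewrite /= lieDl. Qed.

Fact compact_lieDr x y z :
  compact_lie x (y + z) = compact_lie x y + compact_lie x z.
Proof. by apply: val_inj; rewrite /= lieDr. Qed.

Fact compact_lieZl a x y : compact_lie (a *: x) y = a *: compact_lie x y.
Proof. by apply: val_inj; rewrite /= lieZl. Qed.

Fact compact_lieZr a x y : compact_lie x (a *: y) = a *: compact_lie x y.
Proof. by apply: val_inj; rewrite /= lieZr. Qed.

Fact compact_liexx x : compact_lie x x = 0.
Proof. by apply: val_inj; rewrite /= liexx. Qed.

Fact compact_lie_jacobi x y z :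
  compact_lie x (compact_lie y z) + compact_lie y (compact_lie z x)
    + compact_lie z (compact_lie x y) = 0.
Proof. by apply: val_inj; rewrite /= lie_jacobi. Qed.

HB.instance Definition _ := Lmodule_isLieAlgebra.Build R compact_form
  compact_lieDl compact_lieDr compact_lieZl compact_lieZr
  compact_liexx compact_lie_jacobi.

End CompactForm.

Definition nondegenerate_form (K : comNzRingType) (V : lmodType K)
    (B : V -> V -> K) : Prop :=
  forall x, (forall y, B x y = 0) -> x = 0.

Section Signature.
Variables (F : realFieldType) (V : lmodType F).

Definition is_subspace (P : V -> Prop) : Prop :=
  P 0 /\ forall a x y, P x -> P y -> P (a *: x + y).

Definition infinite_dimensional (P : V -> Prop) : Prop :=
  forall m, exists2 v : 'I_m -> V, (forall i, P (v i))
    & forall c : 'I_m -> F, \sum_i c i *: v i = 0 -> forall i, c i = 0.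

Definition one_dimensional (N : V -> Prop) : Prop :=
  exists2 v, v != 0 & forall x, N x <-> exists c, x = c *: v.

Definition positive_definite_on (B : V -> V -> F) (P : V -> Prop) : Prop :=
  forall x, P x -> x != 0 -> 0 < B x x.

Definition negative_definite_on (B : V -> V -> F) (N : V -> Prop) : Prop :=
  forall x, N x -> x != 0 -> B x x < 0.

Definition orthogonal_decomposition (B : V -> V -> F)
    (P N : V -> Prop) : Prop :=
  [/\ forall x, exists p q, [/\ P p, N q & x = p + q],
      forall x, P x -> N x -> x = 0
    & forall p q, P p -> N q -> B p q = 0].

Definition lorentzian_infty_1 (B : V -> V -> F) : Prop :=
  exists P N : V -> Prop,
    [/\ is_subspace P /\ is_subspace N,
        orthogonal_decomposition B P N,
        infinite_dimensional P /\ positive_definite_on B P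
      & one_dimensional N /\ negative_definite_on B N].

End Signature.

(* Main.v *)
From HB Require Import structures.
Require Import Defs.
From mathcomp Require Import all_boot all_order all_algebra.
From mathcomp Require Import boolp reals.
From mathcomp Require Import complex.
From mathcomp Require Import ring lra.
Import Order.TTheory GRing.Theory Num.Theory.
Local Open Scope ring_scope.

(* Writing [star x = - omega x], the form [H(x, y) = B(x, star y)] is hermitian
   and contravariant, [H([z, x], y) = H(x, [star z, y])], and on the compact
   form [- B] is twice the real part of [H] on the span [n+] of the positive
   root vectors plus the form [S = (eps_i a_ij)], [eps_i = B(e_i, f_i)], on the
   real span of the [i h_j].

   [S] is Lorentzian: it is positive semidefinite on vectors with a zero entry,
   since proper principal submatrices are of finite or affine type, but not on
   all vectors, since [A] is of neither type.

   [H] is positive definite on [n+] (Kac-Peterson), by induction on the height.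
   If [(u)] is an orthonormal basis of the part of smaller height, the partial
   Casimir operator [x |-> sum_u [u, [star u, x]]] acts on the root space of [k]
   by [c = 2 (rho, k) - (k, k)], so that
   [c H(x, x) = sum_u H([star u, x], [star u, x])], and [c > 0] for every
   positive root [k] which is not simple.

   Finally [n+] is infinite-dimensional, because each positive root pairs
   negatively with some simple coroot and can be raised. *)

Set Implicit Arguments.
Unset Strict Implicit.
Unset Printing Implicit Defensive.

(** * Symmetric matrices of hyperbolic type *)

(** The presentation of [g] gives neither a basis nor root multiplicities, so all subspaces are
    spans of bracket words, graded by height. What takes the place of a structure theory is this. As
    [S] is Lorentzian, [A] is invertible, so the [h j] separate the points of the root lattice and
    distinct weights are orthogonal for [H]. Nondegeneracy of [B] then descends to [H] on each
    height, and the Casimir identity can be verified after applying the [f j].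

    Positivity and orthonormal families have to be produced together: a family exists in a given
    height only because [H] is already known to be positive there. The Casimir sum is cut off below
    the height of [x], which keeps every [[star u, x]] inside [n+]. Its scalar vanishes on simple
    roots, so height one is treated directly: there [H] is diagonal with entries [eps i]. *)

Section MatrixForm.
Variables (F : realFieldType) (n : nat) (S : 'M[F]_n).
Implicit Types (x y z u : 'cV[F]_n).

Definition mxform x y : F := \sum_i x i 0 * (S *m y) i 0.

Lemma mxformE x y : mxform x y = \sum_i \sum_j S i j * (x i 0 * y j 0).
Proof.
apply: eq_bigr => i _; rewrite mxE big_distrr /=; apply: eq_bigr => j _.
by rewrite mulrCA.
Qed.

Lemma mxformDl x y z : mxform (x + y) z = mxform x z + mxform y z.
Proof. by rewrite -big_split; apply: eq_bigr => i _; rewrite mxE mulrDl. Qed.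

Lemma mxformDr x y z : mxform z (x + y) = mxform z x + mxform z y.
Proof. by rewrite -big_split; apply: eq_bigr => i _;
  rewrite mulmxDr mxE mulrDr. Qed.

Lemma mxformZl a x y : mxform (a *: x) y = a * mxform x y.
Proof. by rewrite big_distrr; apply: eq_bigr => i _; rewrite mxE /= mulrA. Qed.

Lemma mxformZr a x y : mxform x (a *: y) = a * mxform x y.
Proof.
rewrite big_distrr; apply: eq_bigr => i _.
by rewrite -scalemxAr mxE /= mulrCA.
Qed.

Lemma mxform0l y : mxform 0 y = 0.
Proof. by rewrite -(scale0r 0) mxformZl mul0r. Qed.

Hypothesis S_sym : forall i j, S i j = S j i.

Lemma mxformC x y : mxform x y = mxform y x.
Proof.
rewrite !mxformE exchange_big /=; apply: eq_bigr => i _; apply: eq_bigr => j _.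
by rewrite S_sym [y _ _ * _]mulrC.
Qed.

Hypothesis S_off : forall i j, i != j -> S i j <= 0.

(* With [x = u y] entrywise, [2 y_i y_j = y_i^2 + y_j^2 - (y_i - y_j)^2]. *)
Lemma mxform_ge0 u : vec_pos u -> vec_nneg (S *m u) ->
  forall x, 0 <= mxform x x.
Proof.
move=> u_gt0 Su_ge0 x; pose y i := x i 0 / u i 0.
have xE i : x i 0 = u i 0 * y i by rewrite mulrC divfK // gt_eqF.
have -> : mxform x x = \sum_i u i 0 * y i ^+ 2 * (S *m u) i 0
    + 2^-1 * \sum_i \sum_j - S i j * (u i 0 * u j 0) * (y i - y j) ^+ 2.
  pose Z := \sum_i \sum_j S i j * (u i 0 * u j 0) * y i ^+ 2.
  have Z1 : \sum_i u i 0 * y i ^+ 2 * (S *m u) i 0 = Z.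
    apply: eq_bigr => i _; rewrite mxE big_distrr /=; apply: eq_bigr => j _.
    by ring.
  have Z2 : \sum_i \sum_j S i j * (u i 0 * u j 0) * y j ^+ 2 = Z.
    rewrite exchange_big /=; apply: eq_bigr => i _; apply: eq_bigr => j _.
    by rewrite S_sym [u j _ * _]mulrC.
  rewrite Z1 mxformE.
  suff E : \sum_i \sum_j S i j * (x i 0 * x j 0) *+ 2 = Z + Z
     + \sum_i \sum_j - S i j * (u i 0 * u j 0) * (y i - y j) ^+ 2.
    have : (\sum_i \sum_j S i j * (x i 0 * x j 0)) *+ 2 = Z + Z
     + \sum_i \sum_j - S i j * (u i 0 * u j 0) * (y i - y j) ^+ 2.
      by rewrite -E -sumrMnl; apply: eq_bigr => i _; rewrite sumrMnl.
    by lra.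
  rewrite -[X in _ + X + _]Z2 -!big_split /=; apply: eq_bigr => i _.
  rewrite -!big_split /=; apply: eq_bigr => j _; rewrite !xE; ring.
apply: addr_ge0; first by apply: sumr_ge0 => i _;
  rewrite mulr_ge0 ?Su_ge0 // mulr_ge0 ?sqr_ge0 // ltW.
rewrite mulr_ge0 ?invr_ge0 //; apply: sumr_ge0 => i _; apply: sumr_ge0 => j _.
case: (eqVneq i j) => [->|ij]; first by rewrite subrr expr0n mulr0.
by rewrite mulr_ge0 ?sqr_ge0 // mulr_ge0 ?oppr_ge0 ?S_off // mulr_ge0 // ltW.
Qed.

Definition mxabs x : 'cV[F]_n := \col_i `|x i 0|.

Lemma mxabs_nneg x : vec_nneg (mxabs x).
Proof. by move=> i; rewrite mxE. Qed.

Lemma mxabs_eq0 x : (mxabs x == 0) = (x == 0).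
Proof.
apply/eqP/eqP => [x0|->]; apply/matrixP => i j; rewrite ord1 ?mxE ?normr0 //.
by move/matrixP/(_ i 0): x0; rewrite !mxE => /normr0_eq0.
Qed.

(** Off the diagonal [S i j] is nonpositive, so replacing [x i * x j] by its absolute value can only
    lower the sum; the diagonal terms are unchanged. *)
Lemma mxform_abs x : mxform (mxabs x) (mxabs x) <= mxform x x.
Proof.
rewrite !mxformE; apply: ler_sum => i _; apply: ler_sum => j _.
rewrite !mxE; case: (eqVneq i j) => [->|ij]; last first.
  by rewrite ler_wnM2l ?S_off // -normrM ler_norm.
by rewrite -!expr2 real_normK // num_real.
Qed.

(** The form is nonnegative on the line [x + t y] with [y = S x], where its slope at [t = 0] is
    twice the squared norm of [S x]. *)
Lemma mxform_null x : (forall y, 0 <= mxform y y) -> mxform x x = 0 ->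
  S *m x = 0.
Proof.
move=> psd x0; set y := S *m x.
pose b := mxform y x.
have b_eq : b = \sum_i y i 0 ^+ 2 by apply: eq_bigr => i _; rewrite expr2.
have b_ge0 : 0 <= b by rewrite b_eq; apply: sumr_ge0 => i _; rewrite sqr_ge0.
suff /eqP : b = 0.
  rewrite b_eq psumr_eq0 => [/allP y0|i _]; last exact: sqr_ge0.
  apply/matrixP => i j; rewrite ord1 [RHS]mxE.
  by have := y0 i (mem_index_enum _); rewrite sqrf_eq0 => /eqP.
have q_ge0 := psd y; set q := mxform y y in q_ge0.
(* The divisor is [q + 1] because [q] may vanish. With this [t], [2 t b + t^2 q = t b - t^2], and
   [t b <= 0], so [t = 0]. *)
have := psd (x + (- b / (q + 1)) *: y).
rewrite mxformDl !mxformDr !mxformZl !mxformZr x0 (mxformC x y) -/b -/q.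
set t := - b / (q + 1) => pos.
have tq : t * (q + 1) = - b by rewrite /t divfK //; apply: lt0r_neq0; lra.
have tqE : t * (t * q) = t * - b - t * t by rewrite -tq; ring.
rewrite tqE in pos.
have tb0 : t * b <= 0.
  rewrite /t mulrAC mulNr mulNr oppr_le0 divr_ge0 ?mulr_ge0 //; lra.
have t0 : t * t = 0.
  by have := sqr_ge0 t; rewrite expr2; lra.
move/eqP: t0; rewrite mulf_eq0 orbb => /eqP t0.
by move: tq; rewrite t0 mul0r; lra.
Qed.

Hypothesis S_conn : forall T : {set 'I_n}, T != set0 -> T != [set: 'I_n] ->
  exists i j, [/\ i \in T, j \notin T & S i j != 0].

(** Connectedness gives [i] in the zero set of [x] and [j] outside it with [S i j < 0]; the other
    terms of [(S x) i] are nonpositive, so this entry would be negative. *)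
Lemma nneg_pos x : vec_nneg x -> x != 0 -> vec_nneg (S *m x) -> vec_pos x.
Proof.
move=> x_ge0 x_neq0 Sx_ge0 k; rewrite lt_def x_ge0 andbT; apply/negP => xk0.
pose T := [set i | x i 0 == 0].
have T0 : T != set0 by apply/set0Pn; exists k; rewrite inE.
have TT : T != [set: 'I_n].
  apply: contra x_neq0 => /eqP TT; apply/eqP/matrixP => i j.
  by rewrite ord1 mxE; have := in_setT i; rewrite -TT inE => /eqP.
have [i [j [iT jT Sij] ] ] := S_conn T0 TT.
have ij : i != j by apply: contraNneq jT => <-.
have := Sx_ge0 i; rewrite mxE leNgt (bigD1 j) //= => /negP; apply.
rewrite !inE in iT jT; apply: ltr_wnDr.
  apply: sumr_le0 => l lj; case: (eqVneq i l) => [<-|il].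
    by rewrite (eqP iT) mulr0.
  by rewrite mulr_le0_ge0 ?S_off.
by rewrite nmulr_rlt0 lt_def ?jT ?x_ge0 // eq_sym Sij S_off.
Qed.

(** For the parts [xp], [xn] of disjoint support, [0 <= mxform xn (xp - xn)] and [mxform xn xp <= 0]
    give [mxform xn xn <= 0]. *)
Lemma posdef_nneg x : (forall y, y != 0 -> 0 < mxform y y) ->
  vec_nneg (S *m x) -> vec_nneg x.
Proof.
move=> pd Sx_ge0.
pose xp : 'cV[F]_n := \col_i Num.max (x i 0) 0.
pose xn : 'cV[F]_n := \col_i Num.max (- x i 0) 0.
have xE : x = xp + (-1) *: xn.
  apply/matrixP => i j; rewrite ord1 !mxE.
  by rewrite /Num.max; do 2 case: ltP => ?; lra.
have xpn i : xp i 0 * xn i 0 = 0.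
  rewrite !mxE /Num.max; case: ltP => ?; first by rewrite mul0r.
  case: ltP => ?; first by rewrite mulr0.
  have -> : x i 0 = 0 by lra.
  by rewrite mul0r.
have xp_ge0 i : 0 <= xp i 0 by rewrite mxE le_max lexx orbT.
have xn_ge0 i : 0 <= xn i 0 by rewrite mxE le_max lexx orbT.
have xn_le0 : mxform xn xn <= 0.
  have : 0 <= mxform xn x by apply: sumr_ge0 => i _; rewrite mulr_ge0.
  rewrite xE mxformDr mxformZr => h.
  suff : mxform xn xp <= 0 by lra.
  rewrite mxformE; apply: sumr_le0 => i _; apply: sumr_le0 => j _.
  case: (eqVneq i j) => [->|ij]; first by rewrite [xn _ _ * _]mulrC xpn mulr0.
  by rewrite mulr_le0_ge0 ?S_off ?mulr_ge0.
have xn0 : xn = 0.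
  by apply/eqP; apply: contraLR xn_le0 => /pd; rewrite ltNge.
by move=> i; rewrite xE xn0 scaler0 addr0.
Qed.

End MatrixForm.

Lemma ker0_unitmx (F : fieldType) n (M : 'M[F]_n) :
  (forall w : 'cV[F]_n, M *m w = 0 -> w = 0) -> M \in unitmx.
Proof.
move=> M_inj; rewrite -unitmx_tr -row_free_unit -kermx_eq0.
apply/eqP/row_matrixP => i; rewrite row0; apply: trmx_inj; rewrite trmx0.
apply: M_inj; apply: trmx_inj.
by rewrite trmx_mul trmxK trmx0 -row_mul mulmx_ker row0.
Qed.

(** * Finite and affine type through the symmetrized form *)

Section Symmetrized.
Variables (F : realFieldType) (n : nat) (M : 'M[F]_n) (d : 'I_n -> F).

Definition symmx : 'M[F]_n := \matrix_(i, j) (d i * M i j).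

Hypothesis d_gt0 : forall i, 0 < d i.

Lemma symmx_mul x i : (symmx *m x : 'cV[F]_n) i 0 = d i * (M *m x) i 0.
Proof. by rewrite !mxE big_distrr /=; apply: eq_bigr => j _;
  rewrite mxE mulrA. Qed.

Lemma symmx_nneg (x : 'cV[F]_n) : vec_nneg (symmx *m x) <-> vec_nneg (M *m x).
Proof.
by split=> x_ge0 i; have := x_ge0 i; rewrite symmx_mul pmulr_rge0.
Qed.

Lemma symmx_eq0 (x : 'cV[F]_n) : symmx *m x = 0 <-> M *m x = 0.
Proof.
split=> x0; apply/matrixP => i j; rewrite ord1 [RHS]mxE; last first.
  by rewrite symmx_mul x0 mxE mulr0.
have /esym/eqP := symmx_mul x i.
by rewrite x0 [X in _ == X]mxE mulf_eq0 gt_eqF //= => /eqP.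
Qed.

Hypothesis S_sym : forall i j, symmx i j = symmx j i.
Hypothesis M_off : forall i j, i != j -> M i j <= 0.

Let S_off i j : i != j -> symmx i j <= 0.
Proof. by move=> ij; rewrite mxE pmulr_rle0 // M_off. Qed.

Lemma fin_aff_mxform_ge0 : finite_type M \/ affine_type M ->
  forall x, 0 <= mxform symmx x x.
Proof.
case=> [ [_ [u u_gt0 Mu] _]|[_ [u u_gt0 Mu] _] ];
  apply: (mxform_ge0 S_sym S_off u_gt0); apply/symmx_nneg => i.
- exact: ltW.
- by rewrite Mu mxE.
Qed.

Hypothesis M_conn : forall T : {set 'I_n}, T != set0 -> T != [set: 'I_n] ->
  exists i j, [/\ i \in T, j \notin T & M i j != 0].

Let S_conn : forall T : {set 'I_n}, T != set0 -> T != [set: 'I_n] ->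
  exists i j, [/\ i \in T, j \notin T & symmx i j != 0].
Proof.
move=> T T0 TT; have [i [j [iT jT Mij] ] ] := M_conn T0 TT.
by exists i, j; rewrite mxE mulf_neq0 // gt_eqF.
Qed.

(** Absolute values keep the vector isotropic, hence in the kernel, and a nonnegative kernel vector
    of a connected matrix has full support. *)
Lemma nullvec_pos x : (forall y, 0 <= mxform symmx y y) -> x != 0 ->
  mxform symmx x x = 0 -> vec_pos (mxabs x) /\ symmx *m mxabs x = 0.
Proof.
move=> psd x0 qx; have Sx0 : symmx *m mxabs x = 0.
  apply: mxform_null => //; apply/eqP; rewrite eq_le psd andbT -qx.
  exact: mxform_abs.
split=> //; apply: (nneg_pos S_off S_conn (@mxabs_nneg _ _ x)).
  by rewrite mxabs_eq0.
by move=> i; rewrite Sx0 mxE.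
Qed.

(** The vector [x] is automatically positive and makes the form nonnegative. Then [M x = 0] leads to
    affine type and [M x != 0] to finite type. *)
Lemma fin_aff_nneg x : vec_nneg x -> x != 0 -> vec_nneg (M *m x) ->
  finite_type M \/ affine_type M.
Proof.
move=> x_ge0 x0 Mx_ge0; have Sx_ge0 : vec_nneg (symmx *m x) by apply/symmx_nneg.
have x_gt0 : vec_pos x by apply: nneg_pos Sx_ge0.
have psd : forall y, 0 <= mxform symmx y y by apply: mxform_ge0 Sx_ge0.
have [i0 _] : exists i, x i 0 != 0.
  apply/existsP; apply: contraNT x0 => /existsPn xi; apply/eqP/matrixP => i j.
  by rewrite ord1 mxE; have /negPn/eqP := xi i.
have [Mx0|Mx0] := eqVneq (M *m x) 0.
  right; have Sx0 := (symmx_eq0 _).2 Mx0.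
  (* Subtracting a multiple of [x] kills the entry [i0], while a nonzero kernel vector has no zero
     entry; so the kernel is the line of [x]. *)
  have ker w : M *m w = 0 -> w = (w i0 0 / x i0 0) *: x.
    move=> Mw; set z := w - (w i0 0 / x i0 0) *: x.
    have zi0 : z i0 0 = 0 by rewrite !mxE divfK ?subrr // gt_eqF.
    apply: subr0_eq; rewrite -/z; apply/eqP; apply: contra_eqT zi0 => z0.
    have [|+ _] := nullvec_pos psd z0.
      apply: big1 => i _; rewrite (symmx_eq0 z).2 ?mxE ?mulr0 //.
      by rewrite /z mulmxBr -scalemxAr Mw Mx0 scaler0 subr0.
    by move/(_ i0); rewrite mxE normr_gt0.
  split; last 1 first.
  - move=> v Mv_ge0; apply/symmx_eq0; apply/matrixP => i j;
    rewrite ord1 [RHS]mxE.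
    (* [S v >= 0] is orthogonal to the positive vector [x], hence zero. *)
    have : mxform symmx x v = 0.
      by rewrite mxformC //; apply: big1 => k _; rewrite Sx0 mxE mulr0.
    move/eqP; rewrite psumr_eq0 => [/allP/(_ i (mem_index_enum _))|k _].
      by rewrite /= mulf_eq0 (gt_eqF (x_gt0 i)) => /eqP.
    by rewrite mulr_ge0 //; exact: (symmx_nneg v).2.
  - have kM : (kermx M^T :=: x^T)%MS.
      apply/eqmxP; apply/andP; split.
        apply/row_subP => i; set r := row i _.
        have : M *m r^T = 0.
          by apply: trmx_inj;
            rewrite trmx_mul trmxK trmx0 -row_mul mulmx_ker row0.
        by move/ker => rE; rewrite -[r]trmxK rE linearZ scalemx_sub.
      by apply/sub_kermxP; rewrite -trmx_mul Mx0 trmx0.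
    have r1 : \rank x^T = 1%N.
      by rewrite rank_rV -trmx0 (inj_eq trmx_inj) x0.
    have := mxrank_ker M^T; rewrite kM r1 mxrank_tr => nM.
    by rewrite -add1n nM subnK // rank_leq_row.
  - by exists x.
left.
(* A nonzero isotropic [y] would give a positive vector orthogonal to [S x >= 0], forcing
   [S x = 0]. *)
have pd y : y != 0 -> 0 < mxform symmx y y.
  move=> y0; rewrite lt_def psd andbT; apply: contra Mx0 => /eqP qy.
  have [y_gt0 Sy0] := nullvec_pos psd y0 qy.
  apply/eqP/symmx_eq0; apply/matrixP => i j; rewrite ord1 [RHS]mxE.
  have : mxform symmx (mxabs y) x = 0.
    by rewrite mxformC //; apply: big1 => k _; rewrite Sy0 mxE mulr0.
  move/eqP; rewrite psumr_eq0 => [/allP/(_ i (mem_index_enum _))|k _].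
    by rewrite /= mulf_eq0 (gt_eqF (y_gt0 i)) => /eqP.
  by rewrite mulr_ge0 ?Sx_ge0 // ltW.
have M_unit : M \in unitmx.
  apply: ker0_unitmx => w /symmx_eq0 Sw; apply/eqP; apply: contraT => /pd.
  by rewrite /mxform big1 ?ltxx // => i _; rewrite Sw mxE mulr0.
have nn v : vec_nneg (M *m v) -> vec_pos v \/ v = 0.
  move=> /symmx_nneg Sv; have v_ge0 := posdef_nneg S_off pd Sv.
  by have [->|v0] := eqVneq v 0; [right | left; apply: nneg_pos Sv].
split=> //; first by move: M_unit; rewrite unitmxE unitfE.
pose u : 'cV[F]_n := invmx M *m const_mx 1.
have Mu : M *m u = const_mx 1 by rewrite mulKVmx.
have Mu_gt0 : vec_pos (M *m u) by move=> i; rewrite Mu mxE.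
exists u => //; case: (nn u) => [i||u0] //; first exact: ltW.
by move: (Mu_gt0 i0); rewrite u0 mulmx0 mxE ltxx.
Qed.

End Symmetrized.

(** * Signature of the symmetrized hyperbolic matrix *)

Section Hyperbolic.
Variables (F : realFieldType) (n : nat) (A : 'M[int]_n) (d : 'I_n -> F).
Hypothesis A_gcm : is_gcm A.
Hypothesis A_indec : indecomposable A.
Hypothesis A_hyp : hyperbolic_type F A.
Hypothesis d_gt0 : forall i, 0 < d i.
Hypothesis dA_sym : forall i j, d i * (A i j)%:~R = d j * (A j i)%:~R.

Local Notation M := (map_mx intr A : 'M[F]_n).
Local Notation S := (symmx M d).

Let S_sym i j : S i j = S j i.
Proof. by rewrite !mxE. Qed.

Let M_off i j : i != j -> M i j <= 0.
Proof. by case: A_gcm => _ A_off _ ij; rewrite mxE lerz0 A_off. Qed.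

Let S_off i j : i != j -> S i j <= 0.
Proof. by move=> ij; rewrite mxE pmulr_rle0 // M_off. Qed.

Let M_conn (T : {set 'I_n}) : T != set0 -> T != [set: 'I_n] ->
  exists i j, [/\ i \in T, j \notin T & M i j != 0].
Proof.
move=> T0 TT; have [i [j [iT jT Aij] ] ] := A_indec.2 T T0 TT.
exists i, j; split=> //; rewrite mxE intr_eq0.
case: A_gcm => _ _ A0; apply: contraL Aij => /eqP Aij.
by rewrite Aij (A0 _ _ Aij) eqxx.
Qed.

Let restr (T : {set 'I_n}) (x : 'cV[F]_n) : 'cV[F]_n :=
  \col_i (if i \in T then x i 0 else 0).

(** Hyperbolicity speaks only of indecomposable principal submatrices; a decomposable support is cut
    into two smaller orthogonal pieces, by induction on its size. *)
Lemma hyperbolic_support_ge0 (T : {set 'I_n}) (x : 'cV[F]_n) :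
  T != [set: 'I_n] -> (forall i, i \notin T -> x i 0 = 0) ->
  0 <= mxform S x x.
Proof.
have [m] := ubnP #|T|; elim: m T x => // m IHm T x ltT TT xT.
have [T0|T0] := eqVneq T set0.
  by rewrite /mxform big1 // => i _; rewrite xT ?mul0r // T0 inE.
pose AT := principal_submx A T.
have [AT_indec|AT_dec] := pselect (indecomposable AT).
  pose dT (i : 'I_#|T|) := d (enum_val i).
  pose xT' : 'cV[F]_#|T| := \col_i x (enum_val i) 0.
  have sumT (G : 'I_n -> F) : (forall i, i \notin T -> G i = 0) ->
      \sum_i G i = \sum_(i < #|T|) G (enum_val i).
    move=> G0; rewrite -big_enum_val big_mkcond /= [RHS]big_mkcond /=.
    by apply: eq_bigr => i _; case: ifP => // /negbT/G0.
  have -> : mxform S x x = mxform (symmx (map_mx intr AT) dT) xT' xT'.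
    rewrite !mxformE sumT => [|i iT]; last first.
      by apply: big1 => j _; rewrite (xT i) // mul0r mulr0.
    apply: eq_bigr => i _; rewrite sumT => [|j jT].
      by apply: eq_bigr => j _; rewrite !mxE.
    by rewrite (xT j) // !mulr0.
  apply: fin_aff_mxform_ge0.
  - by move=> i; apply: d_gt0.
  - by move=> i j; rewrite !mxE; exact: dA_sym.
  - move=> i j ij; rewrite !mxE lerz0; case: A_gcm => _ A_off _; apply: A_off.
    by rewrite (inj_eq enum_val_inj).
  - by apply: A_hyp.2 => //; rewrite properEneq TT subsetT.
have [U [U0 UT AU] ] : exists U : {set 'I_#|T|}, [/\ U != set0, U != [set: _] &
    forall i j, i \in U -> j \notin U -> AT i j = 0 /\ AT j i = 0].
  apply: contrapT => nU; apply: AT_dec; split; first by rewrite card_gt0.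
  move=> U U0 UT; apply: contrapT => nij; apply: nU; exists U;
    split=> // i j iU jU.
  have [a0|a0] := eqVneq (AT i j) 0; last first.
    by case: nij; exists i, j; rewrite a0.
  have [b0|b0] := eqVneq (AT j i) 0; first by [].
  by case: nij; exists i, j; rewrite b0 orbT.
pose T1 := [set enum_val i | i in U].
pose T2 := T :\: T1.
have T1T : T1 \subset T by apply/subsetP => _ /imsetP[i _ ->]; apply: enum_valP.
have cT1 : #|T1| = #|U| by rewrite card_imset //; apply: enum_val_inj.
have T1_lt : (#|T1| < #|T|)%N.
  rewrite cT1 -[X in (_ < X)%N]card_ord -cardsT; apply: proper_card.
  by rewrite properEneq UT subsetT.
have T2_lt : (#|T2| < #|T|)%N.
  by rewrite cardsD (setIidPr T1T) ltn_subrL !card_gt0 T0 -card_gt0 cT1 card_gt0 U0.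
have xE : x = restr T1 x + restr T2 x.
  apply/matrixP => i j; rewrite ord1 !mxE; rewrite !inE.
  case: (boolP (i \in T1)) => iT1; rewrite ?addr0 //= add0r.
  by case: ifPn => // /xT.
have cross : mxform S (restr T1 x) (restr T2 x) = 0.
  rewrite mxformE; apply: big1 => i _; apply: big1 => j _; rewrite !mxE.
  case: ifP => [/imsetP[i' i'U ->]|_]; last by rewrite mul0r mulr0.
  case: ifP => [|_]; last by rewrite !mulr0.
  rewrite inE => /andP[jT1 jT]; rewrite -(enum_rankK_in jT jT) in jT1 *.
  set j' := enum_rank_in jT j in jT1 *.
  have j'U : j' \notin U by apply: contra jT1 => ?; apply: imset_f.
  by have [] := AU _ _ i'U j'U; rewrite mxE => -> _; rewrite mulr0 mul0r.
have properT' (T' : {set 'I_n}) : (#|T'| < #|T|)%N -> T' != [set: 'I_n].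
  by apply: contraTneq => ->; rewrite -leqNgt cardsT max_card.
rewrite xE mxformDl !mxformDr (mxformC S_sym (restr T2 x)) cross addr0 add0r.
rewrite addr_ge0 //.
- apply: (IHm T1); [exact: leq_trans T1_lt _ | exact: properT' |].
  by move=> i /negPf iT; rewrite mxE iT.
- apply: (IHm T2); [exact: leq_trans T2_lt _ | exact: properT' |].
  by move=> i /negPf iT; rewrite mxE iT.
Qed.

Lemma hyperbolic_neg (x : 'cV[F]_n) :
  vec_nneg x -> x != 0 -> exists i, (M *m x) i 0 < 0.
Proof.
move=> x_ge0 x0; apply: contrapT => Mx; apply: A_hyp.1.
apply: (fin_aff_nneg d_gt0 S_sym M_off M_conn x_ge0 x0) => i.
by rewrite leNgt; apply/negP => Mxi; apply: Mx; exists i.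
Qed.

(** Were the form nonnegative, a nonzero isotropic vector would give a nonnegative kernel vector,
    against [hyperbolic_neg]. So it would be definite, and the preimage of the all-ones vector would
    again be nonnegative, with positive image. *)
Lemma hyperbolic_not_psd : exists v, mxform S v v < 0.
Proof.
apply: contrapT => npsd.
have psd y : 0 <= mxform S y y.
  by rewrite leNgt; apply/negP => y0; apply: npsd; exists y.
have n_gt0 : (0 < n)%N := A_indec.1.
have pd y : y != 0 -> 0 < mxform S y y.
  move=> y0; rewrite lt_def psd andbT; apply/negP => /eqP qy.
  have [_ Sy0] := nullvec_pos d_gt0 S_sym M_off M_conn psd y0 qy.
  have [|i] := hyperbolic_neg (@mxabs_nneg _ _ y).
    by rewrite mxabs_eq0.
  by rewrite ((symmx_eq0 _ d_gt0 _).1 Sy0) mxE ltxx.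
have M_unit : M \in unitmx.
  apply: ker0_unitmx => w /(symmx_eq0 _ d_gt0) Sw; apply/eqP.
  apply: contraT => /pd.
  by rewrite /mxform big1 ?ltxx // => i _; rewrite Sw mxE mulr0.
pose u : 'cV[F]_n := invmx M *m const_mx 1.
have Mu : M *m u = const_mx 1 by rewrite mulKVmx.
have Mu_ge0 : vec_nneg (M *m u) by move=> i; rewrite Mu mxE.
have u_ge0 : vec_nneg u.
  by apply: (posdef_nneg S_off pd); apply/(symmx_nneg _ d_gt0).
have u0 : u != 0.
  apply/negP => /eqP u0; have /matrixP/(_ (Ordinal n_gt0) 0)/eqP := Mu.
  by rewrite u0 mulmx0 !mxE eq_sym oner_eq0.
have [k] := hyperbolic_neg u_ge0 u0.
by rewrite ltNge Mu_ge0.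
Qed.

(* If [q v < 0] and [q w <= 0] with [v] orthogonal to [w], then [w_i v - v_i w]
   vanishes at [i], so [q] is nonnegative there, whence [w_i = 0]. *)
Lemma hyperbolic_lorentzian : exists2 v, mxform S v v < 0 &
  forall w, mxform S v w = 0 -> w != 0 -> 0 < mxform S w w.
Proof.
have [v qv] := hyperbolic_not_psd; exists v => // w vw w0.
rewrite ltNge; apply: contra w0 => qw; apply/eqP/matrixP => i j.
rewrite ord1 mxE; pose x := w i 0 *: v - v i 0 *: w.
have : 0 <= mxform S x x.
  apply: (@hyperbolic_support_ge0 [set~ i]).
    by apply/negP => /eqP/setP/(_ i); rewrite !inE eqxx.
  by move=> k; rewrite !inE negbK => /eqP ->; rewrite !mxE mulrC subrr.
rewrite /x -scaleNr mxformDl !mxformDr !mxformZl !mxformZr.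
rewrite (mxformC S_sym w) vw !mulr0 addr0 add0r.
rewrite !mulrA mulrNN -!expr2 => sum_ge0.
have wq : 0 <= w i 0 ^+ 2 * mxform S v v.
  have : v i 0 ^+ 2 * mxform S w w <= 0 by rewrite mulr_ge0_le0 ?sqr_ge0.
  by lra.
rewrite nmulr_lge0 // in wq.
by apply/eqP; rewrite -sqrf_eq0 eq_le wq sqr_ge0.
Qed.

(** A kernel vector is isotropic and orthogonal to the negative vector [v], hence zero. *)
Lemma hyperbolic_unit : M \in unitmx.
Proof.
have [v qv pos] := hyperbolic_lorentzian.
apply: ker0_unitmx => w /(symmx_eq0 _ d_gt0) Sw.
have f0 y : mxform S y w = 0.
  by rewrite /mxform big1 // => i _; rewrite Sw mxE mulr0.
apply/eqP; apply: contraT => /(pos _ (f0 v)).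
by rewrite f0 ltxx.
Qed.

End Hyperbolic.

(** * Lie algebras with a contravariant form *)

Section LinearSpan.
Variables (K : comNzRingType) (V : lmodType K).
Implicit Types (S : V -> Prop) (x y : V).

Inductive lspan S : V -> Prop :=
  | lspan0 : lspan S 0
  | lspanS a s x : S s -> lspan S x -> lspan S (a *: s + x).

Lemma lspan_mem S x : S x -> lspan S x.
Proof. by move=> Sx; rewrite -[x]addr0 -[x]scale1r;
  apply: lspanS (lspan0 _). Qed.

Lemma lspanD S x y : lspan S x -> lspan S y -> lspan S (x + y).
Proof.
elim=> [|a s z Ss _ IH] Sy; first by rewrite add0r.
by rewrite -addrA; apply: lspanS (IH Sy).
Qed.

Lemma lspanZ S a x : lspan S x -> lspan S (a *: x).
Proof.
elim=> [|b s z Ss _ IH]; first by rewrite scaler0; apply: lspan0.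
by rewrite scalerDr scalerA; apply: lspanS.
Qed.

Lemma lspanN S x : lspan S x -> lspan S (- x).
Proof. by rewrite -scaleN1r; apply: lspanZ. Qed.

Lemma lspanB S x y : lspan S x -> lspan S y -> lspan S (x - y).
Proof. by move=> Sx Sy; apply: lspanD (lspanN Sy). Qed.

Lemma lspan_sum S (I : eqType) (r : seq I) (F : I -> V) :
  (forall i, i \in r -> lspan S (F i)) -> lspan S (\sum_(i <- r) F i).
Proof.
elim: r => [|i r IHr] SF; first by rewrite big_nil; apply: lspan0.
rewrite big_cons; apply: lspanD; first by apply: SF; rewrite mem_head.
by apply: IHr => j jr; apply: SF; rewrite in_cons jr orbT.
Qed.

Lemma lspan_le S S' x : (forall y, S y -> S' y) -> lspan S x -> lspan S' x.
Proof.
move=> SS'; elim=> [|a s z Ss _ IH]; first exact: lspan0.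
by apply: lspanS => //; apply: SS'.
Qed.

End LinearSpan.

Section LieIdentities.
Variables (K : comNzRingType) (L : lieAlgType K).
Implicit Types x y z : L.

Lemma lie0l x : [[0, x]] = 0.
Proof. by have := lieZl 0 (0 : L) x; rewrite !scale0r. Qed.

Lemma lie0r x : [[x, 0]] = 0.
Proof. by rewrite lieC lie0l oppr0. Qed.

Lemma lieBr x y z : [[z, x - y]] = [[z, x]] - [[z, y]].
Proof. by rewrite lieDr lieNr. Qed.

Lemma lie_suml (I : Type) (r : seq I) (F : I -> L) z :
  [[\sum_(i <- r) F i, z]] = \sum_(i <- r) [[F i, z]].
Proof. exact: (big_morph (fun x => [[x, z]]) (fun x y => lieDl x y z) (lie0l z)). Qed.

Lemma lie_sumr (I : Type) (r : seq I) (F : I -> L) z :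
  [[z, \sum_(i <- r) F i]] = \sum_(i <- r) [[z, F i]].
Proof. exact: (big_morph (fun x => [[z, x]]) (fun x y => lieDr z x y) (lie0r z)). Qed.

Lemma lie_der x y z : [[x, [[y, z]] ]] = [[ [[x, y]], z]] + [[y, [[x, z]] ]].
Proof.
have := lie_jacobi x y z.
rewrite (lieC z x) (lieC z [[x, y]]) lieNr -addrA -opprD => /subr0_eq ->.
by rewrite addrC.
Qed.

Lemma lie_nested x y z : [[ [[x, y]], z]] = [[x, [[y, z]] ]] - [[y, [[x, z]] ]].
Proof. by rewrite lie_der addrK. Qed.

Lemma iter_lie_ge p q x y : (p <= q)%N -> iter p (lie x) y = 0 ->
  iter q (lie x) y = 0.
Proof.
move=> /subnKC <- p0; rewrite addnC iterD p0.
by elim: (q - p)%N => //= k ->; rewrite lie0r.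
Qed.

Lemma iter_lie0 p x : iter p (lie x) 0 = 0.
Proof. exact: (iter_lie_ge (leq0n p)). Qed.

Lemma iter_lieD p z x y :
  iter p (lie z) (x + y) = iter p (lie z) x + iter p (lie z) y.
Proof. by elim: p => //= p ->; rewrite lieDr. Qed.

Lemma iter_lieZ p z a x : iter p (lie z) (a *: x) = a *: iter p (lie z) x.
Proof. by elim: p => //= p ->; rewrite lieZr. Qed.

(** By Leibniz, each term of [(ad z)^(p+q) [x, y]] has at least [p] factors on [x] or [q] on [y].
    Peeling off one [ad z] at a time avoids binomial coefficients. *)
Lemma iter_lie_bracket p q z x y : iter p (lie z) x = 0 ->
  iter q (lie z) y = 0 -> iter (p + q) (lie z) [[x, y]] = 0.
Proof.
have [m] := ubnP (p + q); elim: m => // m IHm in p q x y *; rewrite ltnS => pqm.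
case: p pqm => [|p] pqm; first by move=> /= -> _; rewrite lie0l iter_lie0.
case: q pqm => [|q] pqm; first
  by move=> _ y0; rewrite (y0 : y = 0) lie0r iter_lie0.
move=> x0 y0; rewrite addSn iterSr lie_der iter_lieD.
rewrite (IHm p q.+1) ?add0r // -?iterSr // -addSnnS.
by apply: IHm; rewrite -?iterSr // addSnnS.
Qed.

Definition lie_nilp z x := exists p, iter p (lie z) x = 0.

Lemma lie_nilpD z x y : lie_nilp z x -> lie_nilp z y -> lie_nilp z (x + y).
Proof.
move=> [p xp] [q yq]; exists (p + q)%N; rewrite iter_lieD.
by rewrite (iter_lie_ge (leq_addr q p) xp) (iter_lie_ge (leq_addl p q) yq) addr0.
Qed.

Lemma lie_nilpZ z a x : lie_nilp z x -> lie_nilp z (a *: x).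
Proof. by move=> [p xp]; exists p; rewrite iter_lieZ xp scaler0. Qed.

Lemma lie_nilp_bracket z x y : lie_nilp z x -> lie_nilp z y -> lie_nilp z [[x, y]].
Proof. by move=> [p xp] [q yq]; exists (p + q)%N; apply: iter_lie_bracket. Qed.

End LieIdentities.

(** * Representations of sl2 *)

Section Sl2.
Variables (K : numFieldType) (L : lieAlgType K) (e f h : L).
Hypothesis ef : [[e, f]] = h.
Hypothesis hf : [[h, f]] = - 2%:R *: f.

Lemma sl2_wt_iter (c : K) (x : L) m : [[h, x]] = c *: x ->
  [[h, iter m (lie f) x]] = (c - 2%:R * m%:R) *: iter m (lie f) x.
Proof.
move=> hx; elim: m => [|m IHm] /=; first by rewrite mulr0 subr0.
rewrite lie_der hf IHm lieZl lieZr -scalerDl; congr (_ *: _).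
by rewrite -natr1; ring.
Qed.

Lemma sl2_commute (c : K) (x : L) m : [[h, x]] = c *: x ->
  [[e, iter m (lie f) x]] = iter m (lie f) [[e, x]]
    + (m%:R * (c - m%:R + 1)) *: iter m.-1 (lie f) x.
Proof.
move=> hx; elim: m => [|m IHm] /=; first by rewrite mul0r scale0r addr0.
rewrite lie_der ef (sl2_wt_iter _ hx) IHm lieDr lieZr addrCA; congr (_ + _).
case: m {IHm} => [|m] /=; first by rewrite !mul0r scale0r addr0;
  congr (_ *: _); ring.
by rewrite -scalerDl -!natr1; congr (_ *: _); ring.
Qed.

(* Raising with [e], which acts nilpotently, reduces to a highest weight
   vector: [f^r x = 0] implies [f^(r + 1) e x = 0]. *)
Lemma sl2_iter_neq0 N m r (x : L) : (r <= m)%N -> [[h, x]] = m%:R *: x ->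
  [[h, e]] = 2%:R *: e -> iter N (lie e) x = 0 -> iter r (lie f) x = 0 -> x = 0.
Proof.
move=> rm hx he; elim: N => // N IHN in m r x rm hx *.
rewrite iterSr => eNx frx.
have ex0 : [[e, x]] = 0.
  apply: (IHN m.+2 r.+1) => //; first by rewrite ltnS leqW.
  - by rewrite lie_der he hx lieZl lieZr -scalerDl -natrD.
  - have := sl2_commute r.+1 hx; rewrite /= frx lie0r lie0r scaler0 addr0.
    by move <-.
(* Now [e x = 0], and applying [e] to [f^(r+1) x = 0] leaves [(r+1)(m-r) f^r x = 0] with [r < m]. *)
elim: r rm frx => // r IHr rm frx; apply: IHr; first exact: ltnW.
have /esym/eqP := sl2_commute r.+1 hx.
rewrite frx lie0r ex0 iter_lie0 add0r scaler_eq0 => /orP[|/eqP //].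
rewrite mulf_eq0 pnatr_eq0 /= -natr1 opprD addrA addrNK subr_eq0.
by rewrite eqr_nat gtn_eqF.
Qed.

End Sl2.

Section Contravariant.
Variables (C : numClosedFieldType) (n : nat) (A : 'M[int]_n) (g : lieAlgType C).
Variables (e f h : 'I_n -> g) (star : g -> g) (B : {symmetric g}).
Implicit Types (x y z u v : g) (i j : 'I_n) (s : seq 'I_n).

Hypothesis A_diag : forall i, A i i = 2.
Hypothesis A_inj : forall k : 'rV[int]_n, k *m A = 0 -> k = 0.

Hypothesis hh : forall i j, [[h i, h j]] = 0.
Hypothesis he : forall i j, [[h j, e i]] = (A i j)%:~R *: e i.
Hypothesis ef : forall i j, [[e i, f j]] = if i == j then h i else 0.
Hypothesis e_nilp : forall i j, lie_nilp (e i) (e j).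
Hypothesis g_ind : forall P : g -> Prop,
  (forall i, P (e i)) -> (forall i, P (f i)) -> (forall i, P (h i)) ->
  P 0 -> (forall x y, P x -> P y -> P (x + y)) ->
  (forall a x, P x -> P (a *: x)) ->
  (forall x y, P x -> P y -> P [[x, y]]) -> forall x, P x.

Hypothesis starD : forall x y, star (x + y) = star x + star y.
Hypothesis starZ : forall a x, star (a *: x) = a^* *: star x.
Hypothesis starK : forall x, star (star x) = x.
Hypothesis star_lie : forall x y, star [[x, y]] = [[star y, star x]].
Hypothesis star_e : forall i, star (e i) = f i.
Hypothesis star_h : forall i, star (h i) = h i.

Hypothesis B_inv : invariant_form B.
Hypothesis B_nondeg : nondegenerate_form B.
Hypothesis B_pos : forall i, 0 < B (h i) (h i).

Local Lemma star_f i : star (f i) = e i.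
Proof. by rewrite -star_e starK. Qed.

Local Lemma star0 : star 0 = 0.
Proof. by have := starZ 0 0; rewrite conjC0 !scale0r. Qed.

Local Lemma starN x : star (- x) = - star x.
Proof. by rewrite -scaleN1r starZ rmorphN1 scaleN1r. Qed.

Local Lemma star_sum (I : Type) (r : seq I) (F : I -> g) :
  star (\sum_(i <- r) F i) = \sum_(i <- r) star (F i).
Proof. exact: (big_morph star starD star0). Qed.

Local Lemma BC x y : B x y = B y x.
Proof. by rewrite hermC expr0 mul1r. Qed.

Local Lemma BDl x y z : B (x + y) z = B x z + B y z.
Proof. by rewrite linearDl. Qed.
Local Lemma BDr x y z : B z (x + y) = B z x + B z y.
Proof. by rewrite linearDr. Qed.
Local Lemma BZl a x y : B (a *: x) y = a * B x y.
Proof. by rewrite linearZl_LR. Qed.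
Local Lemma BZr a x y : B x (a *: y) = a * B x y.
Proof. by rewrite BC BZl BC. Qed.
Local Lemma B0l x : B 0 x = 0.
Proof. by rewrite linear0l. Qed.
Local Lemma B0r x : B x 0 = 0.
Proof. by rewrite linear0r. Qed.
Local Lemma BNl x y : B (- x) y = - B x y.
Proof. by rewrite linearNl. Qed.
Local Lemma BNr x y : B x (- y) = - B x y.
Proof. by rewrite linearNr. Qed.
Local Lemma B_suml (I : Type) (r : seq I) (F : I -> g) y :
  B (\sum_(i <- r) F i) y = \sum_(i <- r) B (F i) y.
Proof. exact: (big_morph (fun x => B x y) (fun x z => BDl x z y) (B0l y)). Qed.
Local Lemma B_sumr (I : Type) (r : seq I) (F : I -> g) y :
  B y (\sum_(i <- r) F i) = \sum_(i <- r) B y (F i).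
Proof. exact: (big_morph (fun x => B y x) (fun x z => BDr x z y) (B0r y)). Qed.

Local Lemma B_invl x y z : B [[x, y]] z = - B y [[x, z]].
Proof. by rewrite lieC BNl B_inv. Qed.

Local Lemma B_lspan (S : g -> Prop) x y :
  (forall z, S z -> B x z = 0) -> lspan S y -> B x y = 0.
Proof.
move=> S0; elim=> [|a s z Ss _ IH]; first exact: B0r.
by rewrite BDr BZr S0 // IH mulr0 addr0.
Qed.

Local Lemma hf i j : [[h j, f i]] = - (A i j)%:~R *: f i.
Proof.
rewrite -star_e -(star_h j) -star_lie lieC he -scaleNr starZ.
by rewrite rmorphN rmorph_int.
Qed.

Local Lemma f_nilp i j : lie_nilp (f i) (f j).
Proof.
have [p pe] := e_nilp i j; exists p.
have -> : iter p (lie (f i)) (f j) = (-1) ^+ p *: star (iter p (lie (e i)) (e j)).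
  elim: p {pe} => [|p /= ->]; first by rewrite expr0 scale1r /= star_e.
  by rewrite lieZr star_lie star_e lieC exprS mulN1r scaleNr scalerN.
by rewrite pe star0 scaler0.
Qed.

Definition ceps i : C := B (e i) (f i).

Local Notation eps := ceps.

Local Lemma Bhh i j : B (h i) (h j) = (A i j)%:~R * eps i.
Proof.
have -> : h i = [[e i, f i]] by rewrite ef eqxx.
by rewrite B_inv lieC hf scaleNr opprK BZr.
Qed.

Lemma ceps_gt0 i : 0 < eps i.
Proof.
by have := B_pos i; rewrite Bhh A_diag pmulr_rgt0 // ltr0z.
Qed.

Lemma ceps_neq0 i : eps i != 0.
Proof. by rewrite gt_eqF ?ceps_gt0. Qed.

Lemma ceps_sym i j : (A i j)%:~R * eps i = (A j i)%:~R * eps j.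
Proof. by rewrite -!Bhh BC. Qed.

(** * Words, weights and heights *)

Fixpoint word i s : g := if s is j :: s' then [[e j, word i s']] else e i.

Definition word_wt i s : 'rV[int]_n :=
  delta_mx 0 i + \sum_(j <- s) delta_mx 0 j.

Definition ht (k : 'rV[int]_n) : int := \sum_j k 0 j.

(** Weights are row vectors in the root lattice; since [alpha_i(h_j) = a_ij], the value of [k] on
    [h j] is [(k *m A) 0 j]. *)
Definition wt_space (k : 'rV[int]_n) x : Prop :=
  forall j, [[h j, x]] = ((k *m A) 0 j)%:~R *: x.

(* Words with [m] extra letters, that is, of height [m + 1]. *)
Definition hspace m : g -> Prop :=
  lspan (fun x => exists i s, size s = m /\ x = word i s).

Definition nplus : g -> Prop := lspan (fun x => exists i s, x = word i s).

Definition cartan : g -> Prop := lspan (fun x => exists i, x = h i).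

Local Lemma row_delta_A i j : ((delta_mx 0 i : 'rV[int]_n) *m A) 0 j = A i j.
Proof. by rewrite -rowE mxE. Qed.

Local Lemma rowDA (k l : 'rV[int]_n) j :
  ((k + l) *m A) 0 j = (k *m A) 0 j + (l *m A) 0 j.
Proof. by rewrite mulmxDl mxE. Qed.

Local Lemma rowNA (k : 'rV[int]_n) j : ((- k) *m A) 0 j = - (k *m A) 0 j.
Proof. by rewrite mulNmx mxE. Qed.

Lemma wt_space0 k : wt_space k 0.
Proof. by move=> j; rewrite lie0r scaler0. Qed.

Lemma wt_spaceD k x y : wt_space k x -> wt_space k y -> wt_space k (x + y).
Proof. by move=> xk yk j; rewrite lieDr xk yk scalerDr. Qed.

Lemma wt_spaceZ k a x : wt_space k x -> wt_space k (a *: x).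
Proof. by move=> xk j; rewrite lieZr xk !scalerA mulrC. Qed.

Lemma wt_space_lie k l x y : wt_space k x -> wt_space l y ->
  wt_space (k + l) [[x, y]].
Proof.
move=> xk yl j; rewrite lie_der xk yl lieZl lieZr -scalerDl.
by rewrite rowDA intrD.
Qed.

Lemma wt_e i : wt_space (delta_mx 0 i) (e i).
Proof. by move=> j; rewrite he row_delta_A. Qed.

Lemma wt_f i : wt_space (- delta_mx 0 i) (f i).
Proof. by move=> j; rewrite hf rowNA row_delta_A mulrNz. Qed.

Lemma wt_star k x : wt_space k x -> wt_space (- k) (star x).
Proof.
move=> xk j; rewrite -{1}(star_h j) -star_lie lieC xk -scaleNr starZ.
by rewrite rmorphN rmorph_int rowNA mulrNz.
Qed.

Lemma wt_word i s : wt_space (word_wt i s) (word i s).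
Proof.
elim: s => [|j s IHs] /=; first by rewrite /word_wt big_nil addr0; apply: wt_e.
rewrite /word_wt big_cons addrCA; apply: wt_space_lie => //; exact: wt_e.
Qed.

(** Invariance under [h j] gives [(k + l)(h j) B x y = 0] for all [j], and by [A_inj] only
    [k + l = 0] vanishes on every [h j]. *)
Lemma wt_orth k l x y : k + l != 0 -> wt_space k x -> wt_space l y -> B x y = 0.
Proof.
move=> kl xk yl; apply/eqP; apply: contraNT kl => Bxy.
apply/eqP/A_inj/matrixP => i j; rewrite ord1 rowDA [RHS]mxE.
have := B_invl (h j) x y; rewrite xk yl BZl BZr => /eqP.
rewrite -subr_eq0 opprK -mulrDl mulf_eq0 (negPf Bxy) orbF -intrD intr_eq0.
by move=> /eqP.
Qed.

Lemma wt_orth_h k j x : k != 0 -> wt_space k x -> B x (h j) = 0.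
Proof.
move=> k0 xk; apply: (@wt_orth k 0) => //; first by rewrite addr0.
by move=> i; rewrite hh mul0mx mxE scale0r.
Qed.

Lemma word_wt_ge0 i s j : 0 <= word_wt i s 0 j.
Proof.
rewrite mxE summxE addr_ge0 ?mxE // sumr_ge0 // => k _.
by rewrite mxE; case: (_ && _).
Qed.

Lemma ht_delta i : ht (delta_mx 0 i) = 1.
Proof.
by rewrite /ht (bigD1 i) //= mxE !eqxx big1 ?addr0 // => j /negPf ji;
  rewrite mxE ji.
Qed.

Lemma htD k l : ht (k + l) = ht k + ht l.
Proof. by rewrite -big_split; apply: eq_bigr => j _; rewrite mxE. Qed.

Lemma ht_word i s : ht (word_wt i s) = (size s).+1%:Z.
Proof.
rewrite /word_wt htD ht_delta -[(size s).+1]add1n PoszD; congr (_ + _).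
elim: s => [|j s IHs]; first by rewrite big_nil /ht big1 // => j _; rewrite mxE.
by rewrite big_cons htD ht_delta IHs.
Qed.

Lemma word_wt_neq0 i s : word_wt i s != 0.
Proof.
apply/eqP => k0; have := ht_word i s; rewrite k0 /ht big1 // => j _.
by rewrite mxE.
Qed.

Lemma word_wtD_neq0 i s i' s' : word_wt i s + word_wt i' s' != 0.
Proof.
apply/eqP => k0; have := htD (word_wt i s) (word_wt i' s').
rewrite k0 !ht_word {1}/ht big1 => [|j _]; last by rewrite mxE.
by [].
Qed.

Lemma B_word_word i s i' s' : B (word i s) (word i' s') = 0.
Proof. exact: wt_orth (word_wtD_neq0 _ _ _ _) (wt_word _ _) (wt_word _ _). Qed.

Lemma B_word_h i s j : B (word i s) (h j) = 0.
Proof. exact: wt_orth_h (word_wt_neq0 _ _) (wt_word _ _). Qed.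

Lemma B_word_star k x l y : wt_space k x -> wt_space l y -> k != l ->
  B x (star y) = 0.
Proof. by move=> xk yl kl; apply: wt_orth xk (wt_star yl);
  rewrite subr_eq0. Qed.

Lemma hspaceZ m a x : hspace m x -> hspace m (a *: x).
Proof. exact: lspanZ. Qed.

Lemma word_hspace i s m : size s = m -> hspace m (word i s).
Proof. by move=> sm; apply: lspan_mem; exists i, s. Qed.

Lemma hspace_nplus m x : hspace m x -> nplus x.
Proof. by apply: lspan_le => y [i [s [_ ->] ] ]; exists i, s. Qed.

Lemma hspace_ind (P : nat -> g -> Prop) m x :
  (forall i s, size s = m -> P m (word i s)) ->
  P m 0 -> (forall a y z, P m y -> P m z -> P m (a *: y + z)) -> hspace m x -> P m x.
Proof.
move=> Pw P0 PD; elim=> [//|a y z [i [s [sm ->] ] ] _ Pz].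
by apply: PD => //; apply: Pw.
Qed.

Lemma raise_e j m x : hspace m x -> hspace m.+1 [[e j, x]].
Proof.
apply: (hspace_ind (P := fun m x => hspace m.+1 [[e j, x]])).
- by move=> i s sm; apply: (@word_hspace i (j :: s)); rewrite /= sm.
- by rewrite lie0r; apply: lspan0.
- by move=> a y z Hy Hz; rewrite lieDr lieZr; apply: lspanD => //;
  apply: lspanZ.
Qed.

Lemma word_h j i s : [[h j, word i s]] = ((word_wt i s *m A) 0 j)%:~R *: word i s.
Proof. exact: wt_word. Qed.

(** [f j] is moved past the leading letter; [[f j, e k]] is zero or [- h j], which acts on words by
    scalars. The index [m.+1] excludes single letters, which [f j] sends to the Cartan part. *)
Lemma lower_f j m x : hspace m.+1 x -> hspace m [[f j, x]].
Proof.
apply: (hspace_ind (P := fun m x => hspace m.-1 [[f j, x]])) => [i s||a y z Hy Hz].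
- elim: s m => // k s IHs m [sm]; rewrite /= lie_der [ [[f j, e k]] ]lieC ef.
  apply: lspanD.
    rewrite lieNl; case: eqP => _; last by rewrite lie0l oppr0; apply: lspan0.
    by apply: lspanN; rewrite word_h; apply: lspanZ; apply: word_hspace.
  case: s sm IHs => [|k' s'] /= sm IHs; last first.
    by rewrite -sm; apply: raise_e; apply: (IHs (size s')).
  rewrite [ [[f j, e i]] ]lieC ef lieNr; apply: lspanN.
  case: eqP => _; last by rewrite lie0r; apply: lspan0.
  rewrite lieC he; apply: lspanN; apply: lspanZ.
  by apply: (@word_hspace k [::]).
- by rewrite lie0r; apply: lspan0.
- by rewrite lieDr lieZr; apply: lspanD => //; apply: lspanZ.
Qed.

Lemma hspace0P x : hspace 0 x -> exists c : 'I_n -> C, x = \sum_i c i *: e i.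
Proof.
elim=> [|a _ y [i [s [/size0nil-> ->] ] ] _ [c ->] ].
  by exists (fun _ => 0); rewrite big1 // => i _; rewrite scale0r.
exists (fun j => a *+ (j == i) + c j).
rewrite [RHS](eq_bigr (fun j => (a *+ (j == i)) *: e j + c j *: e j));
  last first.
  by move=> j _; rewrite scalerDl.
rewrite big_split /=; congr (_ + _).
by rewrite (bigD1 i) //= eqxx big1 ?addr0 // => j /negPf->; rewrite scale0r.
Qed.

Lemma Bef i j : B (e i) (f j) = if i == j then eps i else 0.
Proof.
case: eqP => [->//|/eqP ij]; apply: (wt_orth _ (wt_e i) (wt_f j)).
rewrite subr_eq0; apply: contraNneq ij => /matrixP/(_ 0 i).
by rewrite !mxE !eqxx /=; case: (i == j).
Qed.

(** The form reads off the coefficient of [e j] in [y]. Turning a bracket into a pairing in this way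
    closes the sums at both ends in [cas_op_step]. *)
Lemma lower_f0 j y : hspace 0 y -> [[f j, y]] = - (B y (f j) / eps j) *: h j.
Proof.
move/hspace0P => [c ->]; rewrite B_suml lie_sumr.
rewrite (bigD1 j) //= [X in X / _](bigD1 j) //= BZl Bef eqxx.
rewrite !big1 => [|i /negPf ij|i /negPf ij]; last 2 first.
- by rewrite BZl Bef ij mulr0.
- by rewrite lieZr lieC ef ij oppr0 scaler0.
rewrite !addr0 mulfK ?gt_eqF ?ceps_gt0 // lieZr lieC ef eqxx.
by rewrite scalerN scaleNr.
Qed.

(** The heights are [d + 1] and [m + 1], so the bracket has height [m - d]; [d < m] keeps it out of
    the Cartan part. *)
Lemma star_lower d m y x : (d < m)%N -> hspace d y -> hspace m x ->
  hspace (m - d.+1) [[star y, x]].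
Proof.
move=> dm Hy Hx; move: Hy dm.
apply: (hspace_ind (P := fun d y => (d < m)%N ->
  hspace (m - d.+1) [[star y, x]])) => [i s <-|_|a {}y z IHy IHz dm].
- elim: s m x Hx => [|k s IHs] [//|m] x Hx /= dm.
    by rewrite star_e subn1; apply: lower_f.
  rewrite star_lie star_e lie_nested subSS; apply: lspanB.
    by apply: IHs => //; apply: lower_f.
  by apply: lower_f; rewrite -subSn //; apply: IHs => //; apply: ltnW.
- by rewrite star0 lie0l; apply: lspan0.
- rewrite starD starZ lieDl lieZl; apply: lspanD; last exact: IHz.
  by apply: lspanZ; apply: IHy.
Qed.

Lemma hspace_lie d m y x : hspace d y -> hspace m x ->
  hspace (d + m).+1 [[y, x]].
Proof.
move=> Hy Hx; move: Hy.
apply: (hspace_ind (P := fun d y => hspace (d + m).+1 [[y, x]]))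
  => [i s <-| |a {}y z IHy IHz].
- elim: s m x Hx => [|k s IHs] m x Hx /=; first exact: raise_e.
  rewrite lie_nested addSn; apply: lspanB; first exact/raise_e/IHs.
  by rewrite -addnS; apply: IHs => //; apply: raise_e.
- by rewrite lie0l; apply: lspan0.
- by rewrite lieDl lieZl; apply: lspanD => //; apply: lspanZ.
Qed.

(** * Triangular decomposition *)

Local Lemma lower_nplus j u : nplus u -> exists v c, [/\ nplus v, cartan c & [[f j, u]] = v + c].
Proof.
elim=> [|a _ y [i [s ->] ] _ [v [c [Hv Hc fy] ] ] ].
  by exists 0, 0; rewrite lie0r addr0; split=> //; apply: lspan0.
rewrite lieDr lieZr fy.
case: s => [|k s].
  exists v, (a *: [[f j, e i]] + c); split=> //; last by rewrite addrCA.
  apply: lspanD => //; apply: lspanZ; rewrite lieC ef; apply: lspanN.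
  by case: eqP => _; [apply: lspan_mem; exists i | apply: lspan0].
exists (a *: [[f j, word i (k :: s)]] + v), c; split=> //;
  last by rewrite addrA.
apply: lspanD => //; apply: lspanZ; apply: (@hspace_nplus (size s)).
exact/lower_f/word_hspace.
Qed.

Local Lemma star_cartan c : cartan c -> cartan (star c).
Proof.
elim=> [|a _ y [i ->] _ IH]; first by rewrite star0; apply: lspan0.
by rewrite starD starZ star_h; apply: lspanS => //; exists i.
Qed.

Local Lemma raise_nplus j u : nplus u -> nplus [[e j, u]].
Proof.
elim=> [|a _ y [i [s ->] ] _ IH]; first by rewrite lie0r; apply: lspan0.
by rewrite lieDr lieZr; apply: lspanS => //; exists i, (j :: s).
Qed.

Local Lemma h_nplus j u : nplus u -> nplus [[h j, u]].
Proof.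
elim=> [|a _ y [i [s ->] ] _ IH]; first by rewrite lie0r; apply: lspan0.
rewrite lieDr lieZr word_h scalerA; apply: lspanS => //; by exists i, s.
Qed.

(** The set [U] of such sums is stable under [star] and under bracketing with [e j] and [h j];
    [star] transfers the former to [f j]. So [U] is a subalgebra containing the generators. *)
Lemma triangular x : exists u c v, [/\ nplus u, cartan c, nplus v & x = u + c + star v].
Proof.
pose U x := exists u c v, [/\ nplus u, cartan c, nplus v & x = u + c + star v].
have Un u : nplus u -> U u.
  by exists u, 0, 0; rewrite star0 !addr0; split=> //; apply: lspan0.
have Uc c : cartan c -> U c.
  by exists 0, c, 0; rewrite star0 add0r addr0; split=> //; apply: lspan0.
have Us u : U u -> U (star u).
  move=> [u' [c [v [Hu Hc Hv ->] ] ] ]; exists v, (star c), u'; split=> //.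
    exact: star_cartan.
  by rewrite !starD starK addrC [star u' + _]addrC addrA.
have UD y z : U y -> U z -> U (y + z).
  move=> [u [c [v [Hu Hc Hv ->] ] ] ] [u' [c' [v' [Hu' Hc' Hv' ->] ] ] ].
  exists (u + u'), (c + c'), (v + v'); split; try exact: lspanD.
  by rewrite starD addrACA; congr (_ + _); rewrite addrACA.
have UZ a y : U y -> U (a *: y).
  move=> [u [c [v [Hu Hc Hv ->] ] ] ].
  exists (a *: u), (a *: c), (a^* *: v); split; try exact: lspanZ.
  by rewrite starZ conjCK !scalerDr.
have UN y : U y -> U (- y) by rewrite -scaleN1r; apply: UZ.
have eh j c : cartan c -> nplus [[e j, c]].
  elim=> [|a _ y [i ->] _ IH]; first by rewrite lie0r; apply: lspan0.
  rewrite lieDr lieZr lieC he -scaleNr scalerA; apply: lspanS => //.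
  by exists j, [::].
have Ue j y : U y -> U [[e j, y]].
  move=> [u [c [v [Hu Hc Hv ->] ] ] ]; rewrite !lieDr; apply: (UD _ _ _ _);
    first apply: UD.
  - exact/Un/raise_nplus.
  - exact/Un/eh.
  - rewrite -star_f -star_lie lieC starN; apply: UN; apply: Us.
    have [v' [c' [Hv' Hc' ->] ] ] := lower_nplus j Hv.
    by apply: UD; [apply: Un | apply: Uc].
have Uh j y : U y -> U [[h j, y]].
  move=> [u [c [v [Hu Hc Hv ->] ] ] ]; rewrite !lieDr; apply: (UD _ _ _ _);
    first apply: UD.
  - exact/Un/h_nplus.
  - suff -> : [[h j, c]] = 0 by apply/Un/lspan0.
    elim: Hc => [|a _ z [i ->] _ IH]; first by rewrite lie0r.
    by rewrite lieDr lieZr hh IH scaler0 addr0.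
  - rewrite -(star_h j) -star_lie lieC starN; apply: UN; apply/Us/Un.
    exact: h_nplus.
have Uf j y : U y -> U [[f j, y]].
  move=> Uy; rewrite -star_e -(starK y) -star_lie lieC starN; apply/UN/Us/Ue.
  exact: Us.
have Uad y : forall z, U z -> U [[y, z]].
  elim/g_ind: y => [j z|j z|j z|z _|y y' IHy IHy' z Uz|a y IHy z Uz|y y' IHy IHy' z Uz].
  - exact: Ue.
  - exact: Uf.
  - exact: Uh.
  - by rewrite lie0l; apply/Un/lspan0.
  - by rewrite lieDl; apply: UD; [apply: IHy | apply: IHy'].
  - by rewrite lieZl; apply: UZ; apply: IHy.
  - rewrite lie_nested; apply: UD; first exact/IHy/IHy'.
    exact/UN/IHy'/IHy.
have Ue' j : U (e j) by apply/Un/lspan_mem; exists j, [::].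
apply: (g_ind (P := U)) => [|j|j| |||y y' _];
  [exact: Ue'| | | | exact: UD | exact: UZ | exact: Uad].
- by rewrite -star_e; apply/Us/Ue'.
- by apply/Uc/lspan_mem; exists j.
- exact/Un/lspan0.
Qed.

Lemma cartan_sum c : cartan c -> exists a : 'I_n -> C, c = \sum_i a i *: h i.
Proof.
elim=> [|a _ y [i ->] _ [c' ->] ].
  by exists (fun _ => 0); rewrite big1 // => i _; rewrite scale0r.
exists (fun j => a *+ (j == i) + c' j).
rewrite [RHS](eq_bigr (fun j => (a *+ (j == i)) *: h j + c' j *: h j));
  last first.
  by move=> j _; rewrite scalerDl.
rewrite big_split /=; congr (_ + _).
by rewrite (bigD1 i) //= eqxx big1 ?addr0 // => j /negPf->; rewrite scale0r.
Qed.

(** * The hermitian form and its nondegeneracy by height *)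

Lemma B_nplus_nplus u v : nplus u -> nplus v -> B u v = 0.
Proof.
move=> Hu Hv; apply: B_lspan Hv => _ [i [s ->] ]; rewrite BC.
by apply: B_lspan Hu => _ [i' [s' ->] ]; apply: B_word_word.
Qed.

Lemma B_nplus_h u j : nplus u -> B u (h j) = 0.
Proof.
move=> Hu; rewrite BC; apply: B_lspan Hu => _ [i [s ->] ]; rewrite BC.
exact: B_word_h.
Qed.

Lemma B_star_nplus_h u j : nplus u -> B (star u) (h j) = 0.
Proof.
elim=> [|a _ y [i [s ->] ] _ IH]; first by rewrite star0 B0l.
rewrite starD starZ BDl BZl IH addr0.
by rewrite (wt_orth_h _ _ (wt_star (wt_word i s))) ?mulr0 // oppr_eq0 word_wt_neq0.
Qed.

(* An invariant form is determined by its restriction to the [h i]. *)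
Lemma B_star x y : B (star x) (star y) = (B x y)^*.
Proof.
have Bh j z : B (h j) (star z) = (B (h j) z)^*.
  have [u [c [v [Hu Hc Hv ->] ] ] ] := triangular z.
  rewrite !starD !BDr ![B (h j) _]BC starK.
  rewrite !(B_nplus_h _ Hu) !(B_nplus_h _ Hv) !(B_star_nplus_h _ Hu).
  rewrite !(B_star_nplus_h _ Hv).
  rewrite !addr0 !add0r; have [a ->] := cartan_sum Hc.
  rewrite star_sum !B_suml rmorph_sum; apply: eq_bigr => i _.
  rewrite starZ star_h !BZl rmorphM Bhh rmorphM rmorph_int.
  by rewrite /= (geC0_conj (ltW (ceps_gt0 i))).
(* By invariance, an element satisfying the identity for all [y] passes it on to every bracket that
   starts with it. *)
move: y; have Pbr z : (forall y, B (star z) (star y) = (B z y)^*) ->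
    forall z' y, B (star [[z, z']]) (star y) = (B [[z, z']] y)^*.
  move=> Pz z' y; rewrite star_lie lieC BNl !B_inv -Pz -star_lie lieC starN BNr.
  by rewrite opprK.
have PZ z a : (forall y, B (star z) (star y) = (B z y)^*) ->
    forall y, B (star (a *: z)) (star y) = (B (a *: z) y)^*.
  by move=> Pz y; rewrite starZ !BZl Pz rmorphM.
have Ph j y : B (star (h j)) (star y) = (B (h j) y)^* by rewrite star_h Bh.
have two0 : 2%:R != 0 :> C by rewrite pnatr_eq0.
elim/g_ind: x => [j|j|j|y|x x' Px Px' y|a x Px y|x x' Px Px' y].
(* Since [a_jj = 2], [e j] is a multiple of a bracket starting with [h j]. *)
- have -> : e j = 2%:R^-1 *: [[h j, e j]] by rewrite he A_diag scalerA mulVf // scale1r.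
  exact/PZ/Pbr/Ph.
- have -> : f j = (- 2%:R^-1) *: [[h j, f j]].
    by rewrite hf A_diag scalerA mulrNN mulVf // scale1r.
  exact/PZ/Pbr/Ph.
- exact: Ph.
- by rewrite star0 !B0l conjC0.
- by rewrite starD !BDl Px Px' rmorphD.
- exact: PZ.
- exact: Pbr.
Qed.

Lemma herm_sym x y : B y (star x) = (B x (star y))^*.
Proof. by rewrite -B_star starK BC. Qed.

Lemma herm_adj x y z : B [[x, y]] (star z) = B y (star [[star x, z]]).
Proof. by rewrite lieC BNl B_inv star_lie starK [in RHS]lieC BNr. Qed.

(** The other components of any [y] are orthogonal to [x] by weight or height, so nondegeneracy of
    [B] is tested on one height alone. *)
Lemma hspace_eq0 m x : hspace m x ->
  (forall i s, size s = m -> B x (star (word i s)) = 0) -> x = 0.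
Proof.
move=> Hx x0; apply: B_nondeg => y.
have [u [c [v [Hu Hc Hv ->] ] ] ] := triangular y.
have Hx' := hspace_nplus Hx.
rewrite !BDr B_nplus_nplus // add0r.
have -> : B x c = 0.
  have [a ->] := cartan_sum Hc; rewrite B_sumr big1 // => i _.
  by rewrite BZr B_nplus_h ?mulr0.
rewrite add0r; elim: Hv => [|a _ y' [i [s ->] ] _ IH];
  first by rewrite star0 B0r.
rewrite starD starZ BDr BZr IH addr0.
have [sm|sm] := eqVneq (size s) m; first by rewrite x0 ?mulr0.
rewrite BC (B_lspan _ Hx) ?mulr0 // => _ [i' [s' [sm' ->] ] ]; rewrite BC.
apply: (B_word_star (wt_word _ _) (wt_word _ _)).
apply: contraNneq sm => kk; have := ht_word i' s'.
by rewrite kk ht_word sm' => -[->].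
Qed.

(** A word with at least two letters is [[e j, w]], and [H(x, [e j, w]) = H([f j, x], w)]. *)
Lemma hspace_lower_eq0 m x : hspace m.+1 x -> (forall j, [[f j, x]] = 0) -> x = 0.
Proof.
move=> Hx fx; apply: (hspace_eq0 Hx) => i [//|j s] _ /=.
by rewrite herm_sym herm_adj star_e fx star0 B0r conjC0.
Qed.

Lemma hspace_orth m m' x y : m != m' -> hspace m x -> hspace m' y ->
  B x (star y) = 0.
Proof.
move=> mm' Hx; elim=> [|a _ z [i [s [sm ->] ] ] _ IH];
  first by rewrite star0 B0r.
rewrite starD starZ BDr BZr IH addr0 BC.
rewrite (B_lspan _ Hx) ?mulr0 // => _ [i' [s' [sm' ->] ] ]; rewrite BC.
apply: B_word_star (wt_word _ _) (wt_word _ _) _; apply: contraNneq mm' => kk.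
have := ht_word i' s'.
by rewrite kk ht_word sm sm' => -[->].
Qed.

(** [x] pairs nontrivially with some word of its height, which must then have weight [k]. This makes
    [k] a nonnegative lattice vector. *)
Lemma hspace_word m k x : hspace m x -> wt_space k x -> x != 0 ->
  exists i s, [/\ size s = m, k = word_wt i s & word i s != 0].
Proof.
move=> Hx xk x0; apply: contrapT => nw; case/eqP: x0;
  apply: (hspace_eq0 Hx) => i s sm.
apply/eqP; apply: contrapT => /negP Bxs; apply: nw; exists i, s; split=> //.
- apply: contrapT => /eqP kk; case/eqP: Bxs.
  exact: B_word_star xk (wt_word i s) kk.
- by apply: contraNneq Bxs => ->; rewrite star0 B0r.
Qed.

(** The reproducing formula of an orthonormal basis for [H], taken as the definition because it is
    what the Casimir sums expand with. *)
Definition frame d (b : seq g) : Prop :=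
  (forall u, u \in b -> hspace d u) /\
  forall y, hspace d y -> y = \sum_(u <- b) B y (star u) *: u.

Lemma frame_dual d b y : frame d b -> hspace d y ->
  star y = \sum_(u <- b) B u (star y) *: star u.
Proof.
move=> [_ bP] Hy; rewrite {1}(bP y Hy) star_sum; apply: eq_bigr => u _.
by rewrite starZ -herm_sym.
Qed.

(** * The partial Casimir operator *)

Definition cas_op (b : nat -> seq g) m x : g :=
  \sum_(d < m) \sum_(u <- b d) [[u, [[star u, x]] ]].

(** [f j] acts on [u], on [star u] or on [x]. Its action on [u] in height index [d + 1] cancels its
    action on [star u] in index [d], the matrix coefficients being opposite. Each of the two ends of
    this telescope yields [- (eps j)^-1 [h j, [f j, x]]]. *)
Lemma cas_op_step b m j x : (forall d, (d < m.+1)%N -> frame d (b d)) ->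
  hspace m.+1 x ->
  [[f j, cas_op b m.+1 x]] =
    cas_op b m [[f j, x]] - (2%:R / eps j) *: [[h j, [[f j, x]] ]].
Proof.
move=> bP Hx.
pose S1 d := \sum_(u <- b d) [[ [[f j, u]], [[star u, x]] ]].
pose S2 d := \sum_(u <- b d) [[u, [[ [[f j, star u]], x]] ]].
pose S3 d := \sum_(u <- b d) [[u, [[star u, [[f j, x]] ]] ]].
have S12 d : (d < m)%N -> S1 d.+1 = - S2 d.
  move=> dm; have b1 := bP d (ltnW dm); have b2 := bP d.+1 dm.
  have -> : S1 d.+1 = \sum_(u <- b d.+1) \sum_(v <- b d)
      B [[f j, u]] (star v) *: [[v, [[star u, x]] ]].
    apply: eq_big_seq => u ub; rewrite [in LHS](b1.2 [[f j, u]]).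
      by rewrite lie_suml; apply: eq_bigr => v _; rewrite lieZl.
    exact/lower_f/b2.1.
  rewrite exchange_big /= /S2 -sumrN; apply: eq_big_seq => v vb.
  have -> : [[f j, star v]] = \sum_(u <- b d.+1) - B [[f j, u]] (star v) *: star u.
    rewrite -star_e -star_lie (frame_dual b2); last first.
      by rewrite lieC; apply/lspanN/raise_e/b1.1.
    by apply: eq_bigr => u _; rewrite star_lie star_e B_invl opprK.
  rewrite lie_suml lie_sumr -sumrN; apply: eq_bigr => u _.
  by rewrite lieZl lieZr scaleNr opprK.
(* Lower end: [[f j, u]] is a multiple of [h j], and the coefficients reassemble
   [star (e j) = f j]. *)
have S10 : S1 0 = - (eps j)^-1 *: [[h j, [[f j, x]] ]].
  have b0 := bP 0%N isT.
  rewrite /S1 -{2}(star_e j) (frame_dual b0 (@word_hspace j [::] 0 erefl)) /=.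
  rewrite star_e lie_suml lie_sumr scaler_sumr; apply: eq_big_seq => u ub.
  rewrite lower_f0; last exact: b0.1.
  by rewrite !lieZl lieZr scalerA mulNr mulrC.
(* Upper end: [[star u, x]] has height one, so [[f j, [star u, x]]] is a multiple of [h j], and the
   coefficients reassemble [[f j, x]]. *)
have S23 : S2 m + S3 m = - (eps j)^-1 *: [[h j, [[f j, x]] ]].
  have bm := bP m (ltnSn m).
  have Hfx := lower_f j Hx.
  rewrite {1}(bm.2 _ Hfx) lie_sumr scaler_sumr -big_split /=.
  apply: eq_big_seq => u ub.
  rewrite -lieDr -lie_der lower_f0; last first.
    by have := star_lower (ltnSn m) (bm.1 _ ub) Hx; rewrite subnn.
  rewrite lieZr (lieC u (h j)) scalerN -scaleNr opprK [in RHS]lieZr scalerA.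
  congr (_ *: _); rewrite !B_invl (lieC (f j)) BNr opprK.
  by rewrite mulrC mulNr mulrN.
have -> : [[f j, cas_op b m.+1 x]] = \sum_(d < m.+1) (S1 d + S2 d + S3 d).
  rewrite lie_sumr; apply: eq_bigr => d _.
  rewrite lie_sumr -!big_split; apply: eq_bigr => u _ /=.
  by rewrite lie_der -addrA; congr (_ + _); rewrite -lieDr -lie_der.
pose Z := [[h j, [[f j, x]] ]].
have sumS1 : \sum_(d < m.+1) S1 d = - (eps j)^-1 *: Z - \sum_(d < m) S2 d.
  rewrite big_ord_recl /= S10 -sumrN; congr (_ + _).
  by apply: eq_bigr => d _; rewrite /= S12.
have sumS2 : \sum_(d < m.+1) S2 d = \sum_(d < m) S2 d + S2 m.
  by rewrite big_ord_recr.
have sumS3 : \sum_(d < m.+1) S3 d = cas_op b m [[f j, x]] + S3 m.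
  by rewrite big_ord_recr.
have S3m : S3 m = - (eps j)^-1 *: Z - S2 m by rewrite -S23 addrC addKr.
rewrite !big_split /= sumS1 sumS2 sumS3 S3m !addrA subrK [_ *: Z + S2 m]addrC.
rewrite -!addrA [LHS]addrC !addrA subrK addrAC [LHS]addrC; congr (_ + _).
by rewrite -scalerDl -scaleNr; congr (_ *: _); rewrite -opprD mulrDl mul1r.
Qed.

(* [2 (rho, k) - (k, k)] for [k] in the root lattice. *)
Definition cas (k : 'rV[int]_n) : C :=
  \sum_i (k 0 i * (2 - (k *m A) 0 i))%:~R / eps i.

(** The quadratic expansion along [alpha_j], with [2 (rho, alpha_j) = (alpha_j, alpha_j) = 2 / eps
    j] and [(k, alpha_j) = (k *m A) 0 j / eps j]. *)
Lemma cas_shift k (a : int) j : cas (k + a *: delta_mx 0 j) =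
  cas k + (2 * a * (1 - (k *m A) 0 j - a))%:~R / eps j.
Proof.
have kAE i : ((k + a *: delta_mx 0 j) *m A) 0 i = (k *m A) 0 i + a * A j i.
  by rewrite rowDA -scalemxAl [X in _ + X]mxE row_delta_A.
have kE i : (k + a *: delta_mx 0 j) 0 i = k 0 i + a * (i == j)%:R.
  by rewrite !mxE eqxx /= eq_sym.
have A_eps i : (A j i)%:~R / eps i = (A i j)%:~R / eps j :> C.
  by apply/eqP; rewrite eqr_div ?ceps_neq0 // ceps_sym.
have -> : cas (k + a *: delta_mx 0 j) = \sum_i ((k 0 i * (2 - (k *m A) 0 i))%:~R / eps i
    - a%:~R * ((k 0 i * A i j)%:~R / eps j)
    + (i == j)%:R * ((a * (2 - (k *m A) 0 j - a * 2))%:~R / eps j)).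
  apply: eq_bigr => i _; rewrite kAE kE.
  have -> : a%:~R * ((k 0 i * A i j)%:~R / eps j) = (a * k 0 i * A j i)%:~R / eps i :> C.
    by rewrite !intrM -![_ * _ / _]mulrA A_eps !mulrA.
  case: (eqVneq i j) => [->|ij].
    rewrite A_diag /= mul1r -mulNr -!mulrDl -intrN -!intrD; congr (_%:~R / _).
    by move: ((k *m A) 0 j) (k 0 j) => K1 K2; ring.
  rewrite mul0r addr0 mulr0 addr0 -mulNr -mulrDl -intrN -intrD;
    congr (_%:~R / _).
  by move: ((k *m A) 0 i) (k 0 i) => K1 K2; ring.
rewrite !big_split /= sumrN -mulr_sumr -/(cas k).
have -> : \sum_i (k 0 i * A i j)%:~R / eps j = ((k *m A) 0 j)%:~R / eps j :> C.
  by rewrite -mulr_suml -rmorph_sum /= mxE.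
rewrite (bigD1 j) //= eqxx mul1r big1 ?addr0 => [|i /negPf->];
  last by rewrite mul0r.
rewrite -addrA; congr (_ + _);
  rewrite !mulrA -mulNr -mulrDl -intrM -intrN -intrD.
by congr (_%:~R / _); move: ((k *m A) 0 j) => K1; ring.
Qed.

Lemma cas_delta j : cas (delta_mx 0 j) = 0.
Proof.
have := cas_shift 0 1 j; rewrite add0r scale1r => ->.
rewrite /cas big1 => [|i _]; last by rewrite mxE mul0r mul0r.
by rewrite mul0mx mxE subr0 subrr mulr0 mul0r addr0.
Qed.

Lemma hspace0_wt k x : hspace 0 x -> wt_space k x -> x != 0 ->
  exists j, k = delta_mx 0 j.
Proof.
move=> Hx xk x0; have [i [s [/size0nil -> -> _] ] ] := hspace_word Hx xk x0.
by exists i; rewrite /word_wt big_nil addr0.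
Qed.

Lemma lower_wt k j x : wt_space k x -> wt_space (k - delta_mx 0 j) [[f j, x]].
Proof. by move=> xk; rewrite addrC; apply: wt_space_lie (wt_f j) xk. Qed.

(** Both sides agree after every [f j]: [cas_shift] with step 1 matches the extra term of
    [cas_op_step]. In height one the sum is empty and [cas] vanishes. *)
Lemma cas_opE b m k x : (forall d, (d < m)%N -> frame d (b d)) ->
  hspace m x -> wt_space k x -> cas_op b m x = cas k *: x.
Proof.
elim: m k x => [|m IHm] k x bP Hx xk.
  rewrite /cas_op big_ord0; have [->|x0] := eqVneq x 0;
    first by rewrite scaler0.
  by have [j ->] := hspace0_wt Hx xk x0; rewrite cas_delta scale0r.
apply/subr0_eq/(hspace_lower_eq0 (m := m)) => [|j].
  apply: lspanB; last exact: hspaceZ.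
  apply: lspan_sum => d _; apply: lspan_sum => u ub.
  have Hu := (bP d (ltn_ord d)).1 u ub.
  have -> : m.+1 = (d + (m.+1 - d.+1)).+1.
    by rewrite -addSn subnKC.
  by apply: hspace_lie => //; apply: star_lower.
have xkj := lower_wt j xk.
rewrite lieBr (cas_op_step j bP Hx) (IHm _ _ _ (lower_f j Hx) xkj) => [|d dm];
  last first.
  by apply: bP; apply: ltnW.
rewrite xkj scalerA -scalerBl lieZr -scalerBl.
set l := k - delta_mx 0 j; have -> : k = l + 1 *: delta_mx 0 j.
  by rewrite scale1r subrK.
rewrite cas_shift; set K := (l *m A) 0 j.
have -> : (2 * 1 * (1 - K - 1))%:~R = - (2%:R * K%:~R) :> C.
  have -> : 2 * 1 * (1 - K - 1) = - (2%:R * K) by ring.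
  by rewrite intrN intrM.
rewrite (_ : _ - _ = 0) ?scale0r //.
by rewrite mulNr [2%:R / _ * _]mulrAC subrr.
Qed.

Lemma e_lie_nilp i x : lie_nilp (e i) x.
Proof.
(* The vectors killed by a power of [ad (e i)] form a subalgebra; the exponents 3 and 2 are the
   lengths of the chains [f i, h i, e i] and [h j, e i]. *)
elim/g_ind: x => [j|j|j||x y Hx Hy|a x Hx|x y Hx Hy].
- exact: e_nilp.
- exists 3%N; rewrite /= ef; case: eqP => _; last by rewrite !lie0r.
  by rewrite (lieC (e i) (h i)) he lieNr lieZr liexx scaler0 oppr0.
- by exists 2%N;
  rewrite /= (lieC (e i) (h j)) he lieNr lieZr liexx scaler0 oppr0.
- by exists 0%N.
- exact: lie_nilpD.
- exact: lie_nilpZ.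
- exact: lie_nilp_bracket.
Qed.

Lemma f_lie_nilp i x : lie_nilp (f i) x.
Proof.
elim/g_ind: x => [j|j|j||x y Hx Hy|a x Hx|x y Hx Hy].
- exists 3%N; rewrite /= (lieC (f i) (e j)) ef; case: eqP => _;
  last by rewrite oppr0 !lie0r.
  by rewrite lieNr (lieC (f i) (h j)) hf opprK lieZr liexx scaler0.
- exact: f_nilp.
- by exists 2%N;
  rewrite /= (lieC (f i) (h j)) hf lieNr lieZr liexx scaler0 oppr0.
- by exists 0%N.
- exact: lie_nilpD.
- exact: lie_nilpZ.
- exact: lie_nilp_bracket.
Qed.

Lemma lower_neq0 k i x (p r : nat) : wt_space k x -> x != 0 ->
  (k *m A) 0 i = p%:Z -> (r <= p)%N -> iter r (lie (f i)) x != 0.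
Proof.
move=> xk x0 kp rp; apply: contraNneq x0 => fx0; apply/eqP.
have [N eN] := e_lie_nilp i x.
apply: (sl2_iter_neq0 _ _ rp _ _ eN fx0); first by rewrite ef eqxx.
- by rewrite hf A_diag.
- by rewrite xk kp.
- by rewrite he A_diag.
Qed.

(** [sl2_iter_neq0] for the opposite triple [(f i, e i, - h i)]. *)
Lemma raise_neq0 k i x (p : nat) : wt_space k x -> x != 0 ->
  (k *m A) 0 i = - p%:Z -> iter p (lie (e i)) x != 0.
Proof.
move=> xk x0 kp; apply: contraNneq x0 => ex0; apply/eqP.
have [N fN] := f_lie_nilp i x.
apply: (sl2_iter_neq0 (h := - h i) _ _ (leqnn p) _ _ fN ex0).
- by rewrite lieC ef eqxx.
- by rewrite lieNl he A_diag scaleNr.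
- by rewrite lieNl xk kp mulrNz scaleNr opprK.
- by rewrite lieNl hf A_diag scaleNr opprK.
Qed.

Lemma iter_lower i r m x : hspace (m + r) x -> hspace m (iter r (lie (f i)) x).
Proof. by elim: r x => [|r IHr] x;
  rewrite ?addn0 // addnS iterSr => /(lower_f i)/IHr. Qed.

Lemma iter_raise i r m x : hspace m x -> hspace (m + r) (iter r (lie (e i)) x).
Proof. by elim: r => [|r IHr] Hx; rewrite ?addn0 // addnS;
  apply/raise_e/IHr. Qed.

Lemma iter_lower_wt k i r x : wt_space k x ->
  wt_space (k + (- r%:Z) *: delta_mx 0 i) (iter r (lie (f i)) x).
Proof.
move=> xk; elim: r => [|r IHr]; first by rewrite oppr0 scale0r addr0.
have -> : k + (- r.+1%:Z) *: delta_mx 0 i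
    = k + (- r%:Z) *: delta_mx 0 i - delta_mx 0 i.
  rewrite -addrA; congr (_ + _).
  by rewrite -[X in _ - X]scale1r -scalerBl -opprD addrC -intS.
exact: lower_wt.
Qed.

Lemma iter_raise_wt k i r x : wt_space k x ->
  wt_space (k + r%:Z *: delta_mx 0 i) (iter r (lie (e i)) x).
Proof.
move=> xk; elim: r => [|r IHr]; first by rewrite scale0r addr0.
have -> : k + r.+1%:Z *: delta_mx 0 i
    = delta_mx 0 i + (k + r%:Z *: delta_mx 0 i).
  rewrite addrCA; congr (_ + _).
  by rewrite -[X in X + _]scale1r -scalerDl -intS.
exact: wt_space_lie (wt_e i) IHr.
Qed.

Lemma word_wt_count i s j : word_wt i s 0 j = (count_mem j (i :: s))%:Z.
Proof.
rewrite mxE summxE /= PoszD; congr (_ + _).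
  by rewrite mxE eqxx /= eq_sym; case: (_ == _).
elim: s => [|k s IHs]; first by rewrite big_nil.
rewrite big_cons IHs /= PoszD; congr (_ + _).
by rewrite mxE eqxx /= eq_sym; case: (_ == _).
Qed.

(** The innermost bracket is [[e i, e i]]. Hence no proper multiple of a simple root is the weight
    of a nonzero word. *)
Lemma word_const i j s : all (pred1 i) (j :: s) -> (0 < size s)%N -> word j s = 0.
Proof.
move=> /= /andP[/eqP-> ]; elim: s => // k s IHs /= /andP[/eqP-> si] _.
by case: s si IHs => [|k' s'] si IHs; rewrite ?liexx // IHs // lie0r.
Qed.

(* If [k] pairs positively with some coroot, the simple reflection lowers the
   height of the root [k] and changes [cas] by [2 p / eps i > 0]; otherwise
   [(k, k) <= 0]. *)
Lemma cas_gt0 m k x : hspace m.+1 x -> wt_space k x -> x != 0 -> 0 < cas k.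
Proof.
have [M] := ubnP m; elim: M => // M IHM in m k x *; rewrite ltnS => mM Hx xk x0.
have [i0 [s [sm kE w0] ] ] := hspace_word Hx xk x0.
have k_ge0 j : 0 <= k 0 j by rewrite kE word_wt_ge0.
have [/existsP[i kAi]|/existsPn kA] := boolP [exists i, 0 < (k *m A) 0 i].
  have [p kp] : exists p : nat, (k *m A) 0 i = p%:Z.
    by exists (absz ((k *m A) 0 i)); rewrite gez0_abs // ltW.
  rewrite kp ltz_nat in kAi.
  (* Otherwise [x] is lowered to height one with a nonzero [e i] component, so [k] is a multiple of
     [alpha_i] of height at least two, where all words vanish. *)
  have pm : (p <= m.+1)%N.
    rewrite leqNgt; apply/negP => mp.
    pose z := iter m.+1 (lie (f i)) x.
    have Hz : hspace 0 z by apply: iter_lower; rewrite add0n.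
    have zk := iter_lower_wt i m.+1 xk; rewrite -/z in zk.
    have z0 : [[f i, z]] != 0 by rewrite -iterS; apply: lower_neq0 kp _.
    have Bz : B z (star (e i)) != 0.
      apply: contraNneq z0; rewrite (lower_f0 _ Hz) star_e => ->.
      by rewrite mul0r oppr0 scale0r.
    have k1 : k + - m.+1%:Z *: delta_mx 0 i = delta_mx 0 i.
      apply: contrapT => /eqP kk; case/eqP: Bz.
      exact: B_word_star zk (wt_e i) kk.
    have k2 j : j != i -> k 0 j = 0.
      move=> /negPf ji; move/matrixP/(_ 0 j): k1.
      by rewrite !mxE ji andbF mulr0 addr0.
    case/eqP: w0; apply: (@word_const i); last by rewrite sm.
    apply/allP => j js; apply: contrapT => /negP/k2;
      rewrite kE word_wt_count => /eqP.
    by rewrite eqz_nat -leqn0 leqNgt -has_count has_pred1 js.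
  pose y := iter p (lie (f i)) x.
  have Hy : hspace (m.+1 - p) y by apply: iter_lower; rewrite subnK.
  have y0 : y != 0 by apply: lower_neq0 kp _.
  have yk := iter_lower_wt i p xk; rewrite -/y in yk.
  (* The reflected weight is simple, with [cas = 0], or falls under the induction hypothesis. *)
  have cas_y : 0 <= cas (k + - p%:Z *: delta_mx 0 i).
    case mp : (m.+1 - p)%N Hy => [|m'] Hy.
      by have [j ->] := hspace0_wt Hy yk y0; rewrite cas_delta.
    apply/ltW/(IHM m' _ y) => //; apply: leq_trans mM.
    by rewrite -ltnS -mp ltn_subrL kAi.
  have -> : cas k = cas (k + - p%:Z *: delta_mx 0 i) + (2 * p%:Z)%:~R / eps i.
    rewrite cas_shift kp -addrA -mulrDl -intrD.
    have -> : 2 * - p%:Z * (1 - p%:Z - - p%:Z) + 2 * p%:Z = 0 by ring.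
    by rewrite mul0r addr0.
  by rewrite ltr_wpDl // divr_gt0 ?ceps_gt0 // ltr0z mulr_gt0.
(* Here [k] is nonpositive on all [h j], so every term is nonnegative, and that of the innermost
   letter [i0] is positive. *)
rewrite /cas (bigD1 i0) //= ltr_pwDl //.
  rewrite divr_gt0 ?ceps_gt0 // ltr0z mulr_gt0 //.
    by rewrite kE word_wt_count /= eqxx.
  by rewrite subr_gt0 (le_lt_trans (y := 0)) // leNgt kA.
apply: sumr_ge0 => j _;
  rewrite divr_ge0 ?(ltW (ceps_gt0 j)) // ler0z mulr_ge0 //.
by rewrite subr_ge0 (le_trans (y := 0)) // leNgt kA.
Qed.

(** * Positivity of the hermitian form on [nplus] *)

Definition pos_on (S : g -> Prop) : Prop :=
  forall x, S x -> x != 0 -> 0 < B x (star x).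

(* Gram-Schmidt. *)
Lemma frame_seq (l : seq g) : pos_on (lspan (fun x => x \in l)) ->
  exists b : seq g, (forall u, u \in b -> lspan (fun x => x \in l) u) /\
    forall y, lspan (fun x => x \in l) y -> y = \sum_(u <- b) B y (star u) *: u.
Proof.
elim: l => [|w l IHl] pos.
  exists [::]; split=> // y; elim=> [|a z y' //]; by rewrite big_nil.
have incl x : lspan (fun x => x \in l) x -> lspan (fun x => x \in w :: l) x.
  by apply: lspan_le => z; rewrite in_cons orbC => ->.
have [b [bl bP] ] : exists b : seq g,
    (forall u, u \in b -> lspan (fun x => x \in l) u) /\
    forall y, lspan (fun x => x \in l) y -> y = \sum_(u <- b) B y (star u) *: u.
  by apply: IHl => x /incl; apply: pos.
pose p := \sum_(u <- b) B w (star u) *: u.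
have Hp : lspan (fun x => x \in l) p.
  by apply: lspan_sum => u /bl; apply: lspanZ.
pose w' := w - p.
have w'l z : lspan (fun x => x \in l) z -> B w' (star z) = 0.
  move=> Hz; rewrite BDl BNl; apply/eqP; rewrite subr_eq0; apply/eqP.
  rewrite {1}(bP z Hz) star_sum B_sumr B_suml; apply: eq_bigr => u _.
  by rewrite starZ BZr BZl -herm_sym mulrC.
have decomp y : lspan (fun x => x \in w :: l) y ->
    exists a z, lspan (fun x => x \in l) z /\ y = a *: w' + z.
  elim=> [|a v y' vl _ [a' [z [Hz ->] ] ] ].
    by exists 0, 0; rewrite scale0r addr0; split=> //; apply: lspan0.
  move: vl; rewrite in_cons => /predU1P[->|vl].
    exists (a + a'), (a *: p + z); split; first by apply: lspanD => //;
      apply: lspanZ.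
    rewrite scalerDl addrACA -scalerDr subrK.
    by rewrite addrA.
  exists a', (a *: v + z); split; last by rewrite addrCA.
  by apply: lspanS.
have Hw' : lspan (fun x => x \in w :: l) w'.
  by apply: lspanB; [apply: lspan_mem; rewrite mem_head | apply: incl].
have [w'0|w'0] := eqVneq w' 0.
  exists b; split=> [u /bl/incl//|y /decomp[a [z [Hz ->] ] ] ].
  by rewrite w'0 scaler0 add0r; apply: bP.
have q_gt0 := pos _ Hw' w'0; set q := B w' (star w') in q_gt0.
(* Over the closed field [C] the new vector can be normalized, and [c] is real since [q > 0]. *)
pose c := (sqrtC q)^-1.
have c_q : c * (c * q) = 1.
  by rewrite mulrA -invfM -expr2 sqrtCK mulVf // gt_eqF.
have c_conj : c^* = c by rewrite geC0_conj // invr_ge0 sqrtC_ge0 ltW.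
exists (c *: w' :: b); split=> [u|y /decomp[a [z [Hz ->] ] ] ].
  by rewrite in_cons => /predU1P[->|/bl/incl//]; apply: lspanZ.
rewrite big_cons starZ BZr BDl BZl c_conj -/q.
rewrite [B z (star w')]herm_sym w'l // conjC0 addr0 scalerA; congr (_ *: _ + _).
  by rewrite -[LHS]mulr1 -c_q; ring.
rewrite {1}(bP z Hz); apply: eq_big_seq => u ub.
by rewrite BDl BZl w'l ?mulr0 ?add0r //; apply: bl.
Qed.

(** Each height has finitely many words, indexed by a first letter and a tuple, so Gram-Schmidt
    applies to their list. *)
Lemma frame_exists d : pos_on (hspace d) -> exists b, frame d b.
Proof.
move=> pos; pose l := [seq word p.1 (val p.2) | p : 'I_n * d.-tuple 'I_n].
have lE x : x \in l <-> exists i s, size s = d /\ x = word i s.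
  split=> [/mapP[ [i s] _ ->] | [i [s [/eqP sd ->] ] ] ].
    by exists i, s; rewrite size_tuple.
  by apply/mapP; exists (i, Tuple sd); rewrite ?mem_enum.
have lH x : lspan (fun x => x \in l) x <-> hspace d x.
  by split; apply: lspan_le => y /lE.
have [b [bl bP] ] : exists b : seq g,
    (forall u, u \in b -> lspan (fun x => x \in l) u) /\
    forall y, lspan (fun x => x \in l) y -> y = \sum_(u <- b) B y (star u) *: u.
  by apply: frame_seq => x /lH; apply: pos.
by exists b; split=> [u /bl/lH|y /lH/bP].
Qed.

(** [Q] will be a length condition or [True], so that one splitting serves both [hspace] and
    [nplus]. *)
Lemma wt_split (Q : 'I_n -> seq 'I_n -> Prop) x :
  lspan (fun x => exists i s, Q i s /\ x = word i s) x ->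
  exists (r : seq 'rV[int]_n) (F : 'rV[int]_n -> g),
    [/\ uniq r, x = \sum_(k <- r) F k & forall k, lspan (fun x =>
      exists i s, [/\ Q i s, word_wt i s = k & x = word i s]) (F k)].
Proof.
elim=> [|a _ y [i [s [Qis ->] ] ] _ [r [F [r_uniq yE HF] ] ] ].
  by exists [::], (fun _ => 0); split=> // [|k];
    [rewrite big_nil | apply: lspan0].
pose k0 := word_wt i s.
have Hs : lspan (fun x => exists i s, [/\ Q i s, word_wt i s = k0 & x = word i s])
    (a *: word i s).
  by apply/lspanZ/lspan_mem; exists i, s.
have [k0r|k0r] := boolP (k0 \in r).
  exists r, (fun k => if k == k0 then a *: word i s + F k else F k); split=> //.
    rewrite (bigD1_seq k0) //= eqxx yE (bigD1_seq k0) //= -addrA;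
      congr (_ + (_ + _)).
    by apply: eq_bigr => k /negPf->.
  by move=> k; case: eqP => // ->; apply: lspanD.
exists (k0 :: r), (fun k => if k == k0 then a *: word i s else F k); split.
- by rewrite /= k0r.
- rewrite big_cons eqxx yE; congr (_ + _); apply: eq_big_seq => k kr.
  by case: eqP => // kk; rewrite -kk kr in k0r.
- by move=> k; case: eqP => // ->.
Qed.

Lemma wt_span_wt (Q : 'I_n -> seq 'I_n -> Prop) k x :
  lspan (fun x => exists i s, [/\ Q i s, word_wt i s = k & x = word i s]) x ->
  wt_space k x.
Proof.
elim=> [|a _ y [i [s [_ <- ->] ] ] _ IH]; first exact: wt_space0.
by apply: wt_spaceD => //; apply/wt_spaceZ/wt_word.
Qed.

(* Distinct weight components are orthogonal. *)
Lemma pos_on_split (Q : 'I_n -> seq 'I_n -> Prop) :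
  (forall k, pos_on (lspan (fun x =>
     exists i s, [/\ Q i s, word_wt i s = k & x = word i s]))) ->
  pos_on (lspan (fun x => exists i s, Q i s /\ x = word i s)).
Proof.
move=> pos x /wt_split[r [F [r_uniq -> HF] ] ] x0.
have -> : B (\sum_(k <- r) F k) (star (\sum_(k <- r) F k))
    = \sum_(k <- r) B (F k) (star (F k)).
  rewrite B_suml; apply: eq_big_seq => k kr.
  rewrite star_sum B_sumr (bigD1_seq k) //= big1 ?addr0 // => l lk.
  apply: B_word_star (wt_span_wt (HF k)) (wt_span_wt (HF l)) _.
  by rewrite eq_sym.
have F_ge0 k : 0 <= B (F k) (star (F k)).
  have [->|Fk0] := eqVneq (F k) 0; first by rewrite B0l.
  exact/ltW/(pos k).
have [k kr Fk0] : exists2 k, k \in r & F k != 0.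
  apply: contrapT => nF; case/eqP: x0; rewrite big_seq big1 // => k kr.
  by apply/eqP; apply: contrapT => /negP Fk0; apply: nF; exists k.
rewrite (bigD1_seq k) //= ltr_pwDl //; first exact: (pos k).
by apply: sumr_ge0 => l _.
Qed.

Lemma hspace_pos m : pos_on (hspace m).
Proof.
have [M] := ubnP m; elim: M => // M IHM in m *; rewrite ltnS => mM.
apply: pos_on_split => k x Hkx x0.
have xk := wt_span_wt Hkx.
have Hx : hspace m x.
  by apply: lspan_le Hkx => _ [i [s [sm _ ->] ] ]; exists i, s.
case: m mM Hkx Hx => [|m] mM _ Hx.
  have [j kj] := hspace0_wt Hx xk x0.
  have [c xE] := hspace0P Hx.
  have cE i : B x (f i) = c i * eps i.
    rewrite xE B_suml (bigD1 i) //= BZl Bef eqxx big1 ?addr0 // => l /negPf li.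
    by rewrite BZl Bef li mulr0.
  rewrite {2}xE star_sum B_sumr lt_def; apply/andP; split; last first.
    apply: sumr_ge0 => i _; rewrite starZ BZr star_e cE mulrA [_^* * _]mulrC.
    by rewrite mulr_ge0 ?mul_conjC_ge0 // ltW // ceps_gt0.
  apply: contraNneq x0 => /eqP; rewrite psumr_eq0 => [/allP c0|i _]; last first.
    rewrite starZ BZr star_e cE mulrA [_^* * _]mulrC.
    by rewrite mulr_ge0 ?mul_conjC_ge0 // ltW // ceps_gt0.
  rewrite xE big1 // => i _; have /= := c0 i (mem_index_enum _).
  rewrite starZ BZr star_e cE mulrA [_^* * _]mulrC mulf_eq0 (negPf (ceps_neq0 i)) orbF.
  by rewrite mul_conjC_eq0 => /eqP ->; rewrite scale0r.
have [b bP] : exists b : nat -> seq g, forall d, (d < m.+1)%N -> frame d (b d).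
  have : forall d, exists b, (d < m.+1)%N -> frame d b.
    move=> d; have [dm|dm] := ltnP d m.+1; last by exists [::].
    have [|b bP] := @frame_exists d; first by apply: IHM; apply: leq_trans mM.
    by exists b.
  by move=> /choice[b bP]; exists b.
have c_gt0 := cas_gt0 Hx xk x0.
rewrite -(pmulr_rgt0 _ c_gt0) -BZl -(cas_opE bP Hx xk) /cas_op B_suml.
have Hux (d : 'I_m.+1) u : u \in b d -> hspace (m - d) [[star u, x]].
  by move=> /(bP d (ltn_ord d)).1 Hu; rewrite -subSS; apply: star_lower.
have term_ge0 (d : 'I_m.+1) u : u \in b d ->
    0 <= B [[star u, x]] (star [[star u, x]]).
  move=> ub; have [->|ux0] := eqVneq [[star u, x]] 0; first by rewrite B0l.
  apply/ltW/IHM; [|exact: (Hux d)|exact: ux0].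
  by apply: leq_ltn_trans mM; rewrite leq_subr.
have sumE (d : 'I_m.+1) : B (\sum_(u <- b d) [[u, [[star u, x]] ]]) (star x)
    = \sum_(u <- b d) B [[star u, x]] (star [[star u, x]]).
  by rewrite B_suml; apply: eq_bigr => u _; rewrite herm_adj.
have sum_ge0 (d : 'I_m.+1) : 0 <= B (\sum_(u <- b d) [[u, [[star u, x]] ]]) (star x).
  by rewrite sumE big_seq; apply: sumr_ge0 => u; apply: term_ge0.
rewrite lt_def; apply/andP; split; last by apply: sumr_ge0.
(* If the sum vanished, every [[star u, x]] would be zero, hence also [cas k *: x], although
   [cas k > 0]. *)
apply/negP; rewrite psumr_eq0 // => /allP sum0.
have : cas k *: x == 0.
  rewrite -(cas_opE bP Hx xk); apply/eqP/big1 => d _; rewrite big_seq;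
    apply: big1 => u ub.
  suff -> : [[star u, x]] = 0 by rewrite lie0r.
  apply/eqP; apply: contrapT => /negP ux0.
  have := sum0 d (mem_index_enum _); rewrite /= sumE big_seq psumr_eq0;
    last first.
    by move=> v; apply: term_ge0.
  move/allP/(_ u ub); rewrite ub /= gt_eqF //; apply: IHM (Hux d u ub) ux0.
  by apply: leq_ltn_trans mM; rewrite leq_subr.
by rewrite scaler_eq0 (negPf x0) orbF gt_eqF.
Qed.

(** Words of weight [k] all have height [ht k], so each weight part lies in a single [hspace], whose
    index is one less. *)
Lemma nplus_pos : pos_on nplus.
Proof.
have pos : pos_on (lspan (fun x => exists i s, True /\ x = word i s)).
  apply: pos_on_split => k x Hkx; apply: (@hspace_pos (absz (ht k)).-1).
  apply: lspan_le Hkx => _ [i [s [_ <- ->] ] ]; exists i, s.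
  by rewrite ht_word.
move=> x Hx; apply: pos; apply: lspan_le Hx => _ [i [s ->] ].
by exists i, s.
Qed.

(** * Weights of unbounded height *)

Lemma hspace_unbounded : (0 < n)%N ->
  (forall k : 'rV[int]_n, (forall j, 0 <= k 0 j) -> k != 0 ->
     exists i, (k *m A) 0 i < 0) ->
  forall M, exists m k x, [/\ (M <= m)%N, hspace m x, wt_space k x & x != 0].
Proof.
move=> n_gt0 A_neg; elim=> [|M [m [k [x [Mm Hx xk x0] ] ] ] ].
  pose i0 := Ordinal n_gt0.
  exists 0%N, (delta_mx 0 i0), (e i0); split=> //.
  - exact: (@word_hspace i0 [::]).
  - exact: wt_e.
  - apply/negP => /eqP ei0; have := ceps_gt0 i0.
    by rewrite /ceps ei0 B0l ltxx.
have [i [s [sm kE _] ] ] := hspace_word Hx xk x0.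
have [||j kj] := A_neg k.
- by move=> j; rewrite kE word_wt_ge0.
- by rewrite kE word_wt_neq0.
(* With [p = - k(h j)], the power [(ad (e j))^p] realizes the simple reflection of [k] and is
   injective on its weight space. *)
have [p kp] : exists p : nat, (k *m A) 0 j = - p%:Z.
  by exists (absz ((k *m A) 0 j)); rewrite ltz0_abs // opprK.
have p_gt0 : (0 < p)%N by move: kj; rewrite kp oppr_lt0 ltz_nat.
exists (m + p)%N, (k + p%:Z *: delta_mx 0 j), (iter p (lie (e j)) x); split.
- by rewrite -addn1; apply: leq_add.
- exact: iter_raise.
- exact: iter_raise_wt.
- exact: raise_neq0 kp.
Qed.

(** Halving [x - star x] symmetrizes whichever triangular decomposition was found: the nilpotent
    parts become [u] and [- star u], the Cartan coefficients imaginary. *)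
Lemma anti_fixed_decomp x : star x = - x ->
  exists u (r : 'I_n -> C), [/\ nplus u, forall i, (r i)^* = - r i &
    x = u - star u + \sum_i r i *: h i].
Proof.
move=> sx; have [u [c [v [Hu Hc Hv xE] ] ] ] := triangular x.
have [a cE] := cartan_sum Hc.
exists (2%:R^-1 *: (u - v)), (fun i => 2%:R^-1 * (a i - (a i)^*)); split.
- by apply/lspanZ/lspanB.
- move=> i; rewrite rmorphM rmorphB /= conjCK -mulrN opprB.
  by rewrite fmorphV rmorph_nat.
have -> : x = 2%:R^-1 *: (x - star x).
  by rewrite sx opprK -mulr2n -scaler_nat scalerA mulVf ?scale1r // pnatr_eq0.
have -> : \sum_i (2%:R^-1 * (a i - (a i)^*)) *: h i = 2%:R^-1 *: (c - star c).
  rewrite cE star_sum -sumrB scaler_sumr; apply: eq_bigr => i _.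
  by rewrite starZ star_h -scalerBl scalerA.
rewrite starZ fmorphV rmorph_nat -scalerBr -scalerDr; congr (_ *: _).
rewrite xE !starD starN starK.
by rewrite !opprD !opprK !addrA [LHS](ACl (1*6*4*3*2*5)).
Qed.

Lemma anti_fixed_form u u' (r r' : 'I_n -> C) : nplus u -> nplus u' ->
  B (u - star u + \sum_i r i *: h i) (u' - star u' + \sum_i r' i *: h i) =
  - (B u (star u') + (B u (star u'))^*)
  + \sum_i \sum_j (r i * r' j) * ((A i j)%:~R * eps i).
Proof.
move=> Hu Hu'.
have uh v (s : 'I_n -> C) : nplus v -> B (v - star v) (\sum_i s i *: h i) = 0.
  move=> Hv; rewrite B_sumr big1 // => i _.
  by rewrite BZr BDl BNl B_nplus_h // B_star_nplus_h // subrr mulr0.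
rewrite BDl [B (u - _) _]BDr [B (\sum_i _) _]BDr (uh u) // addr0.
rewrite [B (\sum_i _) (u' - _)]BC (uh u') // add0r; congr (_ + _).
  rewrite BDl !BDr !BNl !BNr (B_nplus_nplus Hu Hu') B_star (B_nplus_nplus Hu Hu').
  rewrite conjC0 !oppr0 add0r addr0 (BC (star u)) (herm_sym u u').
  by rewrite opprD.
rewrite B_suml; apply: eq_bigr => i _; rewrite B_sumr; apply: eq_bigr => j _.
by rewrite BZl BZr Bhh mulrA.
Qed.

End Contravariant.

(** * The compact form *)

Lemma kac_moody_ind (K : comNzRingType) n (A : 'M[int]_n)
    (P : kac_moody K A -> Prop) :
  (forall i, P (km_e K A i)) -> (forall i, P (km_f K A i)) ->
  (forall i, P (km_h K A i)) -> P 0 -> (forall x y, P x -> P y -> P (x + y)) ->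
  (forall a x, P x -> P (a *: x)) ->
  (forall x y, P x -> P y -> P [[x, y]]) -> forall x, P x.
Proof.
move=> Pe Pf Ph P0 PD PZ Pbr; elim/lie_classW;
  elim=> [ [i|i|i]||t Pt u Pu|a t Pt|t Pt u Pu].
- exact: Pe.
- exact: Pf.
- exact: Ph.
- exact: P0.
- by rewrite pi_lieD; apply: PD.
- by rewrite pi_lieZ; apply: PZ.
- by rewrite pi_lieB; apply: Pbr.
Qed.

Section CompactForm.
Variables (R : rcfType) (n : nat) (A : 'M[int]_n).
Local Notation g := (kac_moody R[i] A).
Local Notation k := (compact_form R A).

Section Restriction.
Variable B : {symmetric g}.

(** The real part serves to land in [R]; by [compact_bform_real] nothing is lost. *)
Definition compact_bform (x y : k) : R :=
  complex.Re (- B (compact_val x) (compact_val y)).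

Lemma compact_bform_sym x y : compact_bform x y = compact_bform y x.
Proof. by rewrite /compact_bform hermC expr0 mul1r. Qed.

Lemma compact_bform_linear y : linear_for *%R (compact_bform^~ y).
Proof.
move=> a x x'; rewrite /compact_bform.
have -> : compact_val (a *: x + x') = a%:C%C *: (compact_val x : g) + (compact_val x' : g).
  by [].
rewrite linearDl linearZl_LR /=.
case: (B (compact_val x) _) => p q; case: (B _ _) => p' q' /=.
by rewrite mul0r subr0 opprD mulrN.
Qed.

Fact compact_bform_bilinear : bilinear_for *%R (idfun \; *%R) compact_bform.
Proof.
split=> [y|x]; first exact: compact_bform_linear.
by move=> a y y';
  rewrite compact_bform_sym compact_bform_linear !(compact_bform_sym x).
Qed.

HB.instance Definition _ := bilinear_isBilinear.Build R k k R
  *%R (idfun \; *%R) compact_bform compact_bform_bilinear.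

Lemma compact_bformDl x x' y :
  compact_bform (x + x') y = compact_bform x y + compact_bform x' y.
Proof. by rewrite linearDl. Qed.

Lemma compact_bformZl a x y : compact_bform (a *: x) y = a * compact_bform x y.
Proof. by rewrite linearZl_LR. Qed.

Lemma compact_bformZr a x y : compact_bform x (a *: y) = a * compact_bform x y.
Proof. by rewrite compact_bform_sym compact_bformZl compact_bform_sym. Qed.

Fact compact_bform_hermitian x y :
  compact_bform x y = (-1) ^+ false * idfun (compact_bform y x).
Proof. by rewrite expr0 mul1r compact_bform_sym. Qed.

HB.instance Definition _ := isHermitianSesquilinear.Build R k false idfun
  compact_bform compact_bform_hermitian.

End Restriction.
End CompactForm.

(** * Signature of the compact form *)

Section Signature.
Variables (R : rcfType) (n : nat) (A : 'M[int]_n).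
Hypothesis A_gcm : is_gcm A.
Hypothesis A_indec : indecomposable A.
Hypothesis A_hyp : hyperbolic_type R A.
Local Notation g := (kac_moody R[i] A).
Local Notation k := (compact_form R A).
Local Notation e := (km_e R[i] A).
Local Notation f := (km_f R[i] A).
Local Notation h := (km_h R[i] A).
Variable B : {symmetric g}.
Hypothesis B_inv : invariant_form B.
Hypothesis B_nondeg : nondegenerate_form B.
Hypothesis B_pos : forall i, 0 < B (h i) (h i).

Definition omega_adj (x : g) : g := - omega x.
Local Notation star := omega_adj.

Let A_diag i : A i i = 2. Proof. by case: A_gcm. Qed.
Let hh i j : [[h i, h j]] = 0. Proof. exact: km_hh. Qed.
Let he i j : [[h j, e i]] = (A i j)%:~R *: e i. Proof. exact: km_he. Qed.
Let ef i j : [[e i, f j]] = if i == j then h i else 0. Proof. exact: km_ef. Qed.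

Let e_nilp i j : lie_nilp (e i) (e j).
Proof.
have [->|ij] := eqVneq i j; first by exists 1%N; rewrite /= liexx.
by exists (absz (1 - A j i)); apply: km_serre_e.
Qed.

Let g_ind := @kac_moody_ind R[i] n A.

Let starD x y : star (x + y) = star x + star y.
Proof. by rewrite /star omegaD opprD. Qed.

Let starZ (a : R[i]) x : star (a *: x) = a^* *: star x.
Proof. by rewrite /star omegaZ scalerN. Qed.

Let starK x : star (star x) = x.
Proof. by rewrite /star omegaN opprK omegaK. Qed.

Let star_lie x y : star [[x, y]] = [[star y, star x]].
Proof. by rewrite /star omega_lie lieNl lieNr opprK -lieC. Qed.

Let star_e i : star (e i) = f i.
Proof. by rewrite /star omega_e opprK. Qed.

Let star_h i : star (h i) = h i.
Proof. by rewrite /star omega_h opprK. Qed.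

(** The symmetrizing diagonal is read off from [B] itself, so that [S] is exactly the form on the
    span of the [i h_j]. *)
Let d i : R := complex.Re (ceps e f B i).

Let epsE i : ceps e f B i = (d i)%:C%C.
Proof.
rewrite RRe_real // gtr0_real //.
exact: ceps_gt0 A_diag he ef starZ star_lie star_e star_h B_inv B_pos i.
Qed.

Let d_gt0 i : 0 < d i.
Proof.
have := ceps_gt0 A_diag he ef starZ star_lie star_e star_h B_inv B_pos i.
by rewrite epsE ltcR.
Qed.

Let dA_sym i j : d i * (A i j)%:~R = d j * (A j i)%:~R.
Proof.
have /= := ceps_sym he ef starZ star_lie star_e star_h B_inv i j.
by rewrite !epsE -!(rmorph_int (real_complex R)) -!rmorphM => /complexI;
  rewrite ![_ * d _]mulrC.
Qed.

Let A_inj (l : 'rV[int]_n) : l *m A = 0 -> l = 0.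
Proof.
move=> lA; have A_unit := hyperbolic_unit A_gcm A_indec A_hyp d_gt0 dA_sym.
suff : map_mx intr l = 0 :> 'rV[R]_n.
  move=> l0; apply/matrixP => i j; move/matrixP/(_ i j)/eqP: l0.
  by rewrite !mxE intr_eq0 => /eqP.
apply: (row_free_inj (A := map_mx intr A)); first by rewrite row_free_unit.
by rewrite mul0mx -map_mxM lA map_mx0.
Qed.

Let A_neg (l : 'rV[int]_n) : (forall j, 0 <= l 0 j) -> l != 0 ->
  exists i, (l *m A) 0 i < 0.
Proof.
(* [hyperbolic_neg] concerns columns; for [v = D^-1 l^T] the symmetry of [D A] gives
   [A v = D^-1 (l A)^T]. *)
move=> l_ge0 l0; pose v : 'cV[R]_n := \col_i ((l 0 i)%:~R / d i).
have v_ge0 : vec_nneg v.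
  by move=> i; rewrite mxE divr_ge0 ?ler0z ?(ltW (d_gt0 i)).
have v0 : v != 0.
  apply: contraNneq l0 => /matrixP v0; apply/eqP/matrixP => i j; rewrite ord1.
  have /eqP := v0 j 0; rewrite !mxE mulf_eq0 invr_eq0 (gt_eqF (d_gt0 j)) orbF.
  by rewrite intr_eq0 => /eqP.
have [i Avi] := hyperbolic_neg A_gcm A_indec A_hyp d_gt0 dA_sym v_ge0 v0.
exists i; move: Avi; rewrite mxE.
have -> : \sum_j (map_mx intr A : 'M[R]_n) i j * v j 0 = ((l *m A) 0 i)%:~R / d i.
  rewrite mxE rmorph_sum mulr_suml; apply: eq_bigr => j _.
  rewrite !mxE rmorphM /=.
  have -> : (A i j)%:~R = d j * (A j i)%:~R / d i.
    by rewrite -dA_sym mulrAC mulfV ?mul1r // gt_eqF.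
  have := d_gt0 i; have := d_gt0 j => /lt0r_neq0 dj /lt0r_neq0 di.
  by field; rewrite di dj.
by rewrite pmulr_llt0 ?invr_gt0 // ltrz0.
Qed.

Local Notation S := (symmx (map_mx intr A) d).

Definition cartan_vec (r : 'cV[R]_n) : g := \sum_j ('i%C * (r j 0)%:C%C) *: h j.

Lemma compact_decomp (x : k) : exists u r, nplus e u /\
  (compact_val x : g) = u - star u + cartan_vec r.
Proof.
have sx : star (compact_val x) = - (compact_val x : g).
  by case: x => x /= /eqP xo; rewrite /star xo.
have [u [r [Hu r_im ->] ] ] := anti_fixed_decomp hh he ef g_ind starD starZ
  starK star_lie star_e star_h sx.
exists u, (\col_i complex.Im (r i)); split=> //; rewrite /cartan_vec;
  congr (_ + _).
apply: eq_bigr => i _; rewrite mxE; congr (_ *: _).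
move: (r_im i); case: (r i) => a b /(congr1 (@complex.Re R)) /= aN.
have -> : a = 0 by lra.
by apply/eqP;
  rewrite eq_complex /= !mul0r !mulr0 ?subr0 ?mul1r ?add0r ?addr0 !eqxx.
Qed.

Lemma compact_bformE x y u u' r r' : nplus e u -> nplus e u' ->
  (compact_val x : g) = u - star u + cartan_vec r ->
  (compact_val y : g) = u' - star u' + cartan_vec r' ->
  - B (compact_val x) (compact_val y) =
    ((complex.Re (B u (star u'))) *+ 2 + mxform S r r')%:C%C.
Proof.
move=> Hu Hu' -> ->; rewrite /cartan_vec.
have -> := anti_fixed_form A_diag A_inj hh he ef g_ind starD starZ starK star_lie
  star_e star_h B_inv B_pos (fun j => 'i%C * (r j 0)%:C%C)
  (fun j => 'i%C * (r' j 0)%:C%C) Hu Hu'.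
rewrite opprD opprK rmorphD; congr (_ + _).
  by rewrite addcJ rmorphMn /= mulr_natl.
rewrite mxformE rmorph_sum -sumrN; apply: eq_bigr => i _.
rewrite rmorph_sum -sumrN; apply: eq_bigr => j _.
rewrite epsE !mxE -(rmorph_int (real_complex R)) ['i%C * _ * _]mulrACA -expr2 sqr_i mulN1r mulNr opprK.
by rewrite -!rmorphM mulrC [d i * _]mulrC.
Qed.

Let BkE x y u u' r r' : nplus e u -> nplus e u' ->
  (compact_val x : g) = u - star u + cartan_vec r ->
  (compact_val y : g) = u' - star u' + cartan_vec r' ->
  compact_bform B x y = (complex.Re (B u (star u'))) *+ 2 + mxform S r r'.
Proof. by move=> Hu Hu' xE yE;
  rewrite /compact_bform (compact_bformE Hu Hu' xE yE). Qed.

Lemma compact_bform_real x y :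
  (compact_bform B x y)%:C%C = - B (compact_val x) (compact_val y).
Proof.
have [u [r [Hu xE] ] ] := compact_decomp x.
have [u' [r' [Hu' yE] ] ] := compact_decomp y.
by rewrite (BkE Hu Hu' xE yE) (compact_bformE Hu Hu' xE yE).
Qed.

Lemma compact_elt u r : exists x : k, (compact_val x : g) = u - star u + cartan_vec r.
Proof.
set x := _ + _.
suff ox : omega x = x.
  have xo : (x : realification R g) \in @omega_fixed R n A by apply/eqP.
  by exists (CompactForm xo).
apply: oppr_inj; rewrite -[LHS]/(star x) /x.
rewrite !starD -scaleN1r starZ rmorphN1 scaleN1r starK [star u - u]addrC.
rewrite opprD opprB [- u + _]addrC; congr (_ + _).
rewrite /cartan_vec (big_morph star starD (_ : star 0 = 0)); last first.
  by have := starZ 0 0; rewrite conjC0 !scale0r.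
rewrite -sumrN; apply: eq_bigr => j _; rewrite starZ star_h -scaleNr;
  congr (_ *: _).
by apply/eqP; rewrite eq_complex /=; apply/andP; split; apply/eqP; ring.
Qed.

Lemma compact_lorentzian : lorentzian_infty_1 (compact_bform B).
Proof.
have [v qv vpos] := hyperbolic_lorentzian A_gcm A_indec A_hyp d_gt0 dA_sym.
have S_sym i j : S i j = S j i by rewrite !mxE.
have n0 : nplus e 0 by apply: lspan0.
have B0 x : B x (star 0) = 0.
  have -> : star 0 = 0 by have := starZ 0 0; rewrite conjC0 !scale0r.
  by rewrite linear0r.
have [v0 v0E] := compact_elt 0 v.
have v0v0 : compact_bform B v0 v0 = mxform S v v.
  by rewrite (BkE n0 n0 v0E v0E) B0 /= mul0rn add0r.
have Bv0 x u r : nplus e u -> (compact_val x : g) = u - star u + cartan_vec r ->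
    compact_bform B x v0 = mxform S r v.
  by move=> Hu xE; rewrite (BkE Hu n0 xE v0E) B0 /= mul0rn add0r.
have v0v0_lt0 : compact_bform B v0 v0 < 0 by rewrite v0v0.
have Re_gt0 u : nplus e u -> u != 0 -> 0 < complex.Re (B u (star u)).
  move=> Hu u0; have := nplus_pos A_diag A_inj hh he ef e_nilp g_ind starD starZ
    starK star_lie star_e star_h B_inv B_nondeg B_pos Hu u0.
  by rewrite ltcE => /andP[].
have Re_ge0 u : nplus e u -> 0 <= complex.Re (B u (star u)).
  move=> Hu; have [->|u0] := eqVneq u 0; first by rewrite B0.
  exact/ltW/Re_gt0.
(* The negative line is spanned by [v0], the element of the Cartan part with the negative vector [v]
   of [S] as coordinates; [P] is its orthogonal complement. *)
exists (fun x => compact_bform B x v0 = 0), (fun x => exists c, x = c *: v0).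
split.
- split; split.
  + by rewrite linear0l.
  + by move=> a x y x0 y0;
    rewrite compact_bformDl compact_bformZl x0 y0 mulr0 addr0.
  + by exists 0; rewrite scale0r.
  + by move=> a x y [c ->] [c' ->]; exists (a * c + c');
    rewrite scalerDl scalerA.
- split.
  + move=> x; pose c := compact_bform B x v0 / compact_bform B v0 v0.
    exists (x - c *: v0), (c *: v0); split; [|by exists c|by rewrite subrK].
    by rewrite compact_bformDl -scaleNr compact_bformZl mulNr divfK ?subrr // lt_eqF.
  + move=> x x0 [c xc]; move: x0; rewrite xc compact_bformZl => /eqP.
    by rewrite mulf_eq0 (lt_eqF v0v0_lt0) orbF => /eqP ->; rewrite scale0r.
  + by move=> p q p0 [c ->]; rewrite linearZr_LR /= p0 mulr0.
- split; last first.
    move=> x x0 xn0; have [u [r [Hu xE] ] ] := compact_decomp x.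
    rewrite (Bv0 x u r Hu xE) mxformC // in x0.
    rewrite (BkE Hu Hu xE xE).
    have [r0|r0] := eqVneq r 0.
      rewrite r0 mxform0l addr0 pmulrn_lgt0 //; apply: Re_gt0 => //.
      apply: contraNneq xn0 => u0.
      apply/eqP/val_inj; apply: (etrans xE).
      rewrite u0 r0 sub0r.
      have -> : star 0 = 0 by have := starZ 0 0; rewrite conjC0 !scale0r.
      rewrite oppr0 add0r /cartan_vec big1 // => j _.
      by rewrite mxE mulr0 scale0r.
    by rewrite ltr_wpDl ?vpos // mulrn_wge0 // Re_ge0.
  move=> m.
  have /choice[mm mmP] : forall M, exists m', (M <= m')%N /\
      exists2 x, hspace e m' x & x != 0.
    move=> M; have [m' [l [x [Mm Hx _ x0] ] ] ] := hspace_unbounded A_diag A_inj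
      hh he ef e_nilp g_ind starD starZ starK star_lie star_e star_h B_inv
      B_nondeg B_pos A_indec.1 A_neg M.
    by exists m'; split=> //; exists x.
  (* Each new height is forced beyond the preceding one, which makes the chosen vectors pairwise
     orthogonal, hence independent. *)
  pose idx i := iter i (fun t => (mm t).+1) 0%N.
  have idx_le i j : (i <= j)%N -> (idx i <= idx j)%N.
    elim: j => [|j IHj]; first by rewrite leqn0 => /eqP ->.
    rewrite leq_eqVlt => /predU1P[->//|/IHj idx_ij]; apply: leq_trans idx_ij _.
    by apply: leqW; case: (mmP (idx j)).
  have mm_lt i j : (i < j)%N -> (mm (idx i) < mm (idx j))%N.
    move=> ij; apply: (@leq_trans (idx j)); last by case: (mmP (idx j)).
    exact: (idx_le i.+1 j).
  have [uu uuP] : exists uu : nat -> g, forall i, hspace e (mm (idx i)) (uu i) /\ uu i != 0.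
    have /choice[uu uuP] : forall i, exists x, hspace e (mm (idx i)) x /\ x != 0.
      by move=> i; have [_ [x] ] := mmP (idx i); exists x.
    by exists uu.
  have Huu i : nplus e (uu i) by apply: hspace_nplus (uuP i).1.
  have /choice[w wE] := fun i : nat => compact_elt (uu i) 0.
  exists (fun i : 'I_m => w i) => [i|c cw0 i].
    by rewrite (Bv0 _ _ _ (Huu i) (wE i)) mxform0l.
  have : compact_bform B (\sum_j c j *: w j) (w i) = 0 by rewrite cw0 linear0l.
  rewrite linear_sumlz (bigD1 i) //= big1 ?addr0 => [|j ji]; last first.
    rewrite compact_bformZl (BkE (Huu j) (Huu i) (wE j) (wE i)) mxform0l addr0.
    rewrite (hspace_orth A_inj he starD starZ star_lie star_h B_inv _ (uuP j).1 (uuP i).1).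
      by rewrite /= mul0rn mulr0.
    by case: (ltngtP j i) => [/mm_lt|/mm_lt|/val_inj ij]; rewrite ?ij ?eqxx //;
      [case: ltngtP | case: ltngtP | move: ji; rewrite ij eqxx].
  rewrite compact_bformZl => /eqP; rewrite mulf_eq0 => /orP[/eqP //|].
  rewrite (BkE (Huu i) (Huu i) (wE i) (wE i)) mxform0l addr0 mulrn_eq0 /=.
  by rewrite (gt_eqF (Re_gt0 _ (Huu i) (uuP i).2)).
- split.
    exists v0 => //; apply: contraTneq v0v0_lt0 => ->.
    by rewrite linear0l ltxx.
  move=> x [c ->] cv0; rewrite compact_bformZl compact_bformZr mulrA -expr2.
  rewrite pmulr_rlt0 // lt_def sqr_ge0 andbT sqrf_eq0.
  by apply: contraNneq cv0 => ->; rewrite scale0r.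
Qed.

End Signature.

Unset Implicit Arguments.
Set Strict Implicit.

Theorem lemma3p2 (R : realType) (n : nat) (A : 'M[int]_n)
    (A_gcm : is_gcm A) (A_indec : indecomposable A)
    (A_symm : symmetrizable A) (A_hyp : hyperbolic_type R A)
    (B : {symmetric (kac_moody R[i] A)})
    (B_inv : invariant_form B)
    (B_nondeg : nondegenerate_form B)
    (B_pos : forall i : 'I_n, 0 < B (km_h R[i] A i) (km_h R[i] A i)) :
  exists Bk : {symmetric (compact_form R A)},
    [/\ forall x y : compact_form R A,
          (Bk x y)%:C%C = - B (compact_val x) (compact_val y),
        invariant_form Bk
      & lorentzian_infty_1 Bk].

Proof.
exists (compact_bform B); split.
- exact: (compact_bform_real A_gcm A_indec A_hyp B_inv B_pos).
- move=> x y z; apply: complexI.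
  rewrite !(compact_bform_real A_gcm A_indec A_hyp B_inv B_pos).
  by congr (- _); apply: B_inv.
- exact: (compact_lorentzian A_gcm A_indec A_hyp B_inv B_nondeg B_pos).
Qed.
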